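(* Let $\varphi\in H^\infty$ and suppose that $$\lim_{\vartheta\to0^+}\ \operatorname*{ess\,sup}_{\Gamma(\vartheta)\cap L_\varphi^-(1)}|\varphi| = 0,$$ and that there exist a sequence $(\vartheta_n)_{n\ge1}$ with $\vartheta_n\to0^+$ and positive constants $a,b$ such that for all $n$, $$|\Gamma(\vartheta_n)\cap L_\varphi^-(1)|\ge a|\Gamma(\vartheta_n)| \quad\text{and}\quad |\Gamma(\vartheta_n)\cap L_\varphi^+(1)|\ge b|\Gamma(\vartheta_n)|.$$ Then $\varphi$ is saturated.
   Context: $\mathbb{T}$ is the unit circle with normalized Lebesgue arc length measure, and $|E|$ denotes the measure of $E\subseteq\mathbb{T}$. $H^p$ ($1\le p\le\infty$) is the subspace of $L^p(\mathbb{T})$ of functions with Fourier coefficients supported on $\{0,1,2,\dots\}$, and $H^\infty_0$ is the subspace of $H^\infty$ of functions vanishing at the origin. A function $\varphi\in H^\infty$ is saturated if $\|\varphi\|_\infty = \inf_{f\in H^\infty_0}\|\varphi-\overline{f}\|_\infty$. For a bounded $\psi$ and $0\le\delta\le1$, $L_\psi^+(\delta)=\{e^{i\theta}\in\mathbb{T}: |\psi(e^{i\theta})|\ge\|\psi\|_\infty\delta\}$ and $L_\psi^-(\delta)=\{e^{i\theta}\in\mathbb{T}: |\psi(e^{i\theta})|<\|\psi\|_\infty\delta\}$. For $0<\vartheta\le\pi$, $\Gamma(\vartheta)=\{e^{i\theta}: |\theta|\le\vartheta\}$. *)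

(* Defs.v *)
From HB Require Import structures.
From mathcomp Require Import all_boot all_order all_algebra.
From mathcomp Require Import all_classical all_reals all_analysis.
From mathcomp Require Import ess_sup_inf.
From mathcomp Require Import complex.
Set Implicit Arguments. Unset Strict Implicit. Unset Printing Implicit Defensive.
Import Order.TTheory GRing.Theory Num.Theory.
Import numFieldNormedType.Exports.
Local Open Scope classical_set_scope.
Local Open Scope ring_scope.

(* The unit circle T is parametrised by theta in [-pi, pi] (e^{i theta});
   functions on T are functions R -> C, only their values on [-pi,pi] matter. *)
Section hardy.
Variable R : realType.
Notation C := (complex.complex R).

Definition cRe (z : C) : R := complex.Re z.
Definition cIm (z : C) : R := complex.Im z.
Definition cmk (x y : R) : C := complex.Complex x y.
Definition cabs (z : C) : R := Num.sqrt (cRe z ^+ 2 + cIm z ^+ 2).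
Definition cconj (z : C) : C := cmk (cRe z) (- cIm z).
Definition expi (t : R) : C := cmk (cos t) (sin t).

Definition Tdom : set R := `[- pi, pi].

Definition tmeas (E : set R) : \bar R :=
  (lebesgue_measure (Tdom `&` E) * ((2 * pi)^-1)%:E)%E.

Definition ess_sup_on (D : set R) (g : R -> \bar R) : \bar R :=
  ess_sup lebesgue_measure (fun x => if x \in D then g x else -oo%E).

Definition Linf_norm (f : R -> C) : \bar R :=
  ess_sup_on Tdom (fun t => (cabs (f t))%:E).

Definition fourier_coef (f : R -> C) (n : int) : C :=
  let g := fun t => f t * expi (- (n%:~R * t)) in
  cmk ((2 * pi)^-1 * Rintegral lebesgue_measure Tdom (fun t => cRe (g t)))
      ((2 * pi)^-1 * Rintegral lebesgue_measure Tdom (fun t => cIm (g t))).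

Definition is_Linf (f : R -> C) : Prop :=
  measurable_fun Tdom (fun t => cRe (f t)) /\
  measurable_fun Tdom (fun t => cIm (f t)) /\
  (Linf_norm f < +oo)%E.

Definition is_Hinf (f : R -> C) : Prop :=
  is_Linf f /\ forall n : int, n < 0 -> fourier_coef f n = 0.

(* H^oo_0 : functions of H^oo vanishing at the origin (0-th coefficient 0) *)
Definition is_Hinf0 (f : R -> C) : Prop :=
  is_Hinf f /\ fourier_coef f 0 = 0.

Definition saturated (phi : R -> C) : Prop :=
  Linf_norm phi =
  ereal_inf [set Linf_norm (fun t => phi t - cconj (f t)) | f in is_Hinf0].

Definition Lplus (psi : R -> C) (delta : R) : set R :=
  [set t | Tdom t /\ ((cabs (psi t))%:E >= Linf_norm psi * delta%:E)%E].
Definition Lminus (psi : R -> C) (delta : R) : set R :=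
  [set t | Tdom t /\ ((cabs (psi t))%:E < Linf_norm psi * delta%:E)%E].

Definition Gamma (th : R) : set R := [set t | Tdom t /\ `|t| <= th].

End hardy.

(* Main.v *)
(** Suppose [|phi - conj f| <= r < M] for some [f] in [H^oo], where [M] is the
    norm of [phi].  The function [u = 1 - phi f / M^2] of [H^oo] satisfies
    [|u| <= r / M < 1] on [L^+] and is close to 1 on [L^-] near the point 1, so
    that a high power [v] of [u] is close to the indicator of [L^-] there.  The
    Poisson integral at [1 - theta_n] is multiplicative on [H^oo]; applied to
    [v] and [v^2] it shows that the Poisson mean [m] of [L^-] almost satisfies
    [m = m^2], whereas the density hypotheses bound [m] away from 0 and 1.

    Multiplicativity holds for polynomials in [e^{it}] and extends to their
    [L^1]-limits; the latter contain [H^oo] since the Fejer means of a bounded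
    function converge to it in [L^1]. *)

Require Import Defs.
From HB Require Import structures.
From mathcomp Require Import all_boot all_order all_algebra.
From mathcomp Require Import all_classical all_reals all_analysis.
From mathcomp Require Import ess_sup_inf measurable_realfun.
From mathcomp Require Import complex.
From mathcomp Require Import ring lra.
Import Order.TTheory GRing.Theory Num.Theory.
Import numFieldNormedType.Exports.
Local Open Scope classical_set_scope.
Local Open Scope ring_scope.

Set Implicit Arguments.
Unset Strict Implicit.
Unset Printing Implicit Defensive.

(** * Bounded measurable real functions on the circle and their integrals *)

Section bounded_measurable.
Context {R : realType}.
Implicit Types (f g : R -> R) (M r t x : R).

Local Notation T := (@Tdom R).
Local Notation leb := (@lebesgue_measure R).

(** On [L^+] the modulus of [phi] is [M], so [1 = phi * conj phi / M^2] there and [1 - phi f / M^2 =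
    phi * conj (phi - conj f) / M^2]. This trades the non-analytic difference [phi - conj f] for a
    function of H^oo that it controls. The indicator is approximated only on a small arc around 1.
    Elsewhere the error is merely bounded; it is dominated by a multiple of [1 - cos t], whose
    Poisson mean at [rho] is [1 - rho], so that no estimate of the kernel off the arc is required.
    On the arc [|t| <= theta] the kernel at [1 - theta] is at least [1 / (2 * theta)], which turns
    densities into lower bounds for Poisson means. Essential bounds become bounds at every point
    once the functions are changed on one null set. Boundedness everywhere on [T], as [bmeas]
    demands, makes integrability automatic and is stable under products. *)

Definition bmeas f := measurable_fun T f /\ exists M, forall t, T t -> `|f t| <= M.

Definition intT f : R := Rintegral leb T f.

Lemma pi2_gt0 : 0 < 2 * pi :> R.
Proof. by rewrite mulr_gt0 ?pi_gt0. Qed.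

Lemma pi2_neq0 : 2 * pi != 0 :> R.
Proof. by rewrite gt_eqF// pi2_gt0. Qed.

Lemma TdomE t : T t <-> `|t| <= pi.
Proof. by rewrite /Tdom/= in_itv/= ler_norml. Qed.

Lemma measurable_Tdom : measurable (T : set R).
Proof. exact: measurable_itv. Qed.
Hint Resolve measurable_Tdom : core.

Lemma lebesgue_Tdom : leb T = (2 * pi)%:E.
Proof.
rewrite /Tdom lebesgue_measure_itv/= lte_fin.
have p0 := @pi_gt0 R.
by rewrite ifT ?gtrN//; congr EFin; rewrite opprK mulr_natl mulr2n.
Qed.

Lemma lebesgue_Tdom_fin : (leb T < +oo)%E.
Proof. by rewrite lebesgue_Tdom ltry. Qed.

Lemma bmeas_integrable f : bmeas f -> leb.-integrable T (EFin \o f).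
Proof.
move=> [mf [M fM]]; apply: measurable_bounded_integrable => //.
  exact: lebesgue_Tdom_fin.
exists M; split; first exact: num_real.
by move=> N /ltW MN t /fM /le_trans; apply.
Qed.

Lemma bmeas_cst r : bmeas (fun=> r).
Proof. by split; [exact: measurable_cst | exists `|r|]. Qed.

Lemma bmeasD f g : bmeas f -> bmeas g -> bmeas (fun t => f t + g t).
Proof.
move=> [mf [M fM]] [mg [N gN]]; split; first exact: measurable_funD.
exists (M + N) => t Tt; apply: (le_trans (ler_normD _ _)).
by rewrite lerD ?fM ?gN.
Qed.

Lemma bmeasM f g : bmeas f -> bmeas g -> bmeas (fun t => f t * g t).
Proof.
move=> [mf [M fM]] [mg [N gN]]; split; first exact: measurable_funM.
by exists (M * N) => t Tt; rewrite normrM ler_pM ?fM ?gN.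
Qed.

Lemma bmeasZ r f : bmeas f -> bmeas (fun t => r * f t).
Proof. by move=> ?; apply: bmeasM => //; exact: bmeas_cst. Qed.

Lemma eq_bmeas f g : f =1 g -> bmeas f -> bmeas g.
Proof. by move=> /funext ->. Qed.

Lemma bmeasN f : bmeas f -> bmeas (fun t => - f t).
Proof. by move/(bmeasZ (-1)); apply: eq_bmeas => t; rewrite mulN1r. Qed.

Lemma bmeasB f g : bmeas f -> bmeas g -> bmeas (fun t => f t - g t).
Proof. by move=> bf bg; apply: bmeasD => //; exact: bmeasN. Qed.

Lemma bmeas_norm f : bmeas f -> bmeas (fun t => `|f t|).
Proof.
move=> [mf [M fM]]; split; first exact: measurableT_comp.
by exists M => t Tt; rewrite normr_id fM.
Qed.

Lemma bmeas_indic (A : set R) : measurable A -> bmeas (\1_A).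
Proof.
move=> mA; split; first exact: measurable_indic.
by exists 1 => t _; rewrite indicE; case: (_ \in _); rewrite ?normr1 ?normr0.
Qed.

Lemma bmeas_continuous f : continuous f -> bmeas f.
Proof.
move=> cf; split.
  by apply: measurable_funTS; exact: continuous_measurable_fun.
have : compact (f @` T).
  apply: continuous_compact; first exact: continuous_subspaceT.
  exact: segment_compact.
move=> /compact_bounded[M [_ +]] => /(_ (M + 1)).
rewrite ltrDl ltr01 => /(_ isT) H; exists (M + 1) => t Tt.
by apply: H; exists t.
Qed.

Lemma intTD f g : bmeas f -> bmeas g ->
  intT (fun t => f t + g t) = intT f + intT g.
Proof. by move=> ? ?; apply: RintegralD => //; exact: bmeas_integrable. Qed.

Lemma intTZ r f : bmeas f -> intT (fun t => r * f t) = r * intT f.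
Proof. by move=> ?; apply: RintegralZl => //; exact: bmeas_integrable. Qed.

Lemma eq_intT f g : (forall t, T t -> f t = g t) -> intT f = intT g.
Proof. by move=> fg; apply: eq_Rintegral => t /set_mem /fg. Qed.

Lemma intTB f g : bmeas f -> bmeas g ->
  intT (fun t => f t - g t) = intT f - intT g.
Proof.
move=> bf bg; rewrite intTD//; last exact: bmeasN.
congr (_ + _); rewrite -mulN1r -intTZ//.
by apply: eq_intT => t _; rewrite mulN1r.
Qed.

Lemma le_intT f g : bmeas f -> bmeas g -> (forall t, T t -> f t <= g t) ->
  intT f <= intT g.
Proof. by move=> *; apply: le_Rintegral => //; exact: bmeas_integrable. Qed.

Lemma intT_ge0 f : (forall t, T t -> 0 <= f t) -> 0 <= intT f.
Proof. by move=> ?; apply: Rintegral_ge0. Qed.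

Lemma intT_norm f : bmeas f -> `|intT f| <= intT (fun t => `|f t|).
Proof. by move=> ?; apply: le_normr_Rintegral => //; exact: bmeas_integrable. Qed.

Lemma intT_cst r : intT (fun=> r) = 2 * pi * r.
Proof.
rewrite /intT Rintegral_cst//; rewrite [X in fine X]lebesgue_Tdom/=.
exact: mulrC.
Qed.

Lemma intT_indic (A : set R) : measurable A -> 
  (intT (\1_A))%:E = leb (T `&` A).
Proof.
move=> mA; rewrite /intT /Rintegral integral_indic// setIC fineK//.
apply/fin_real; rewrite (lt_le_trans (ltNyr 0%R))//=.
apply: le_lt_trans lebesgue_Tdom_fin; apply: le_measure; rewrite ?inE//.
exact: measurableI.
Qed.

Lemma is_derive_continuous (F f : R -> R) :
  (forall x, is_derive x 1 F (f x)) -> continuous F.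
Proof.
move=> dF x; apply: differentiable_continuous; apply/derivable1_diffP.
by have [] := dF x.
Qed.

Lemma intT_FTC (F f : R -> R) : (forall x, is_derive x 1 F (f x)) ->
  continuous f -> intT f = F pi - F (- pi).
Proof.
move=> dF cf; have cF := is_derive_continuous dF.
rewrite /intT /Rintegral /Tdom (@continuous_FTC2 _ _ F)//.
- by rewrite gtrN// pi_gt0.
- exact: continuous_subspaceT.
- split.
  + by move=> x _; have [] := dF x.
  + by apply: cvg_at_right_filter; exact: cF.
  + by apply: cvg_at_left_filter; exact: cF.
- by move=> x _; rewrite derive1E; have [_ ->] := dF x.
Qed.

Lemma is_derive_sinM r x : is_derive x 1 (fun t => sin (r * t)) (r * cos (r * x)).
Proof. by apply: is_derive_eq; rewrite /GRing.scale/= mulr1 mulrC. Qed.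

Lemma is_derive_cosM r x : is_derive x 1 (fun t => cos (r * t)) (- (r * sin (r * x))).
Proof. by apply: is_derive_eq; rewrite /GRing.scale/= mulr1 mulrC mulrN. Qed.

Lemma continuous_cosM r : continuous (fun t => cos (r * t)).
Proof. exact: is_derive_continuous (is_derive_cosM r). Qed.

Lemma continuous_sinM r : continuous (fun t => sin (r * t)).
Proof. exact: is_derive_continuous (is_derive_sinM r). Qed.

Lemma sin_natpi (n : nat) : sin (n%:R * pi) = 0 :> R.
Proof.
elim: n => [|n IH]; first by rewrite mul0r sin0.
by rewrite -natr1 mulrDl mul1r sinD IH sinpi mul0r mulr0 addr0.
Qed.

Lemma sin_intpi (n : int) : sin (n%:~R * pi) = 0 :> R.
Proof.
case: n => n; first exact: sin_natpi.
by rewrite NegzE mulrNz mulNr sinN sin_natpi oppr0.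
Qed.

Lemma intT_cos (n : int) : intT (fun t => cos (n%:~R * t)) = 2 * pi * (n == 0)%:R.
Proof.
have [->|n0] := eqVneq n 0.
  by rewrite -intT_cst; apply: eq_intT => t _; rewrite mul0r cos0.
have n0' : (n%:~R : R) != 0 by rewrite intr_eq0.
have dF x : is_derive x 1 (fun t => (n%:~R)^-1 * sin (n%:~R * t)) (cos (n%:~R * x)).
  have := is_deriveZ (n%:~R)^-1 (is_derive_sinM n%:~R x).
  by rewrite /GRing.scale/= mulrA mulVf// mul1r.
rewrite mulr0 (intT_FTC dF); last exact: continuous_cosM.
by rewrite mulrN sinN sin_intpi oppr0 mulr0 subr0.
Qed.

Lemma intT_sin (n : int) : intT (fun t => sin (n%:~R * t)) = 0.
Proof.
have [->|n0] := eqVneq n 0.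
  by rewrite -[RHS](mulr0 (2 * pi)) -intT_cst; apply: eq_intT => t _; rewrite mul0r sin0.
have n0' : (n%:~R : R) != 0 by rewrite intr_eq0.
have dF x : is_derive x 1 (fun t => - (n%:~R)^-1 * cos (n%:~R * t)) (sin (n%:~R * x)).
  have := is_deriveZ (- (n%:~R)^-1) (is_derive_cosM n%:~R x).
  by rewrite /GRing.scale/= mulrN mulNr opprK mulrA mulVf// mul1r.
rewrite (intT_FTC dF); last exact: continuous_sinM.
by rewrite mulrN cosN subrr.
Qed.

End bounded_measurable.

(** * Complex modulus, exponentials and integrals of bounded complex functions *)

Section complex_bounded_measurable.
Context {R : realType}.
Local Notation C := (complex.complex R).
Local Notation T := (@Tdom R).
Implicit Types (z w c : C) (F G : R -> C) (t x : R).

Definition rc (x : R) : C := real_complex R x.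

Lemma ceqP z w : cRe z = cRe w -> cIm z = cIm w -> z = w.
Proof. by case: z; case: w => ? ? ? ? /= -> ->. Qed.

Lemma cRe_rc x : cRe (rc x) = x. Proof. by []. Qed.
Lemma cReD z w : cRe (z + w) = cRe z + cRe w. Proof. by case: z; case: w. Qed.
Lemma cImD z w : cIm (z + w) = cIm z + cIm w. Proof. by case: z; case: w. Qed.
Lemma cReN z : cRe (- z) = - cRe z. Proof. by case: z. Qed.
Lemma cImN z : cIm (- z) = - cIm z. Proof. by case: z. Qed.
Lemma cReM z w : cRe (z * w) = cRe z * cRe w - cIm z * cIm w.
Proof. by case: z; case: w. Qed.
Lemma cImM z w : cIm (z * w) = cRe z * cIm w + cIm z * cRe w.
Proof. by case: z; case: w. Qed.
Lemma cRe_rcM x z : cRe (rc x * z) = x * cRe z.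
Proof. by rewrite cReM /= mul0r subr0. Qed.
Lemma cIm_rcM x z : cIm (rc x * z) = x * cIm z.
Proof. by rewrite cImM /= mul0r addr0. Qed.

Lemma rcM x y : rc (x * y) = rc x * rc y. Proof. exact: rmorphM. Qed.
Lemma rcB x y : rc (x - y) = rc x - rc y. Proof. exact: rmorphB. Qed.
Lemma rc0 : rc 0 = 0. Proof. by []. Qed.
Lemma rc1 : rc 1 = 1. Proof. by []. Qed.

Lemma cabsE z : cabs z = ComplexField.Normc.normc z.
Proof. by case: z. Qed.

Lemma cabs_ge0 z : 0 <= cabs z. Proof. exact: sqrtr_ge0. Qed.

Lemma cabsM z w : cabs (z * w) = cabs z * cabs w.
Proof. by rewrite !cabsE ComplexField.Normc.normcM. Qed.

Lemma le_cabsD z w : cabs (z + w) <= cabs z + cabs w.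
Proof. by rewrite !cabsE le_normcD. Qed.

Lemma cabsN z : cabs (- z) = cabs z.
Proof. by rewrite /cabs cReN cImN !sqrrN. Qed.

Lemma cabsB z w : cabs (z - w) = cabs (w - z).
Proof. by rewrite -cabsN opprB. Qed.

Lemma le_cabsB z w : cabs (z - w) <= cabs z + cabs w.
Proof. by rewrite (le_trans (le_cabsD _ _))// cabsN. Qed.

Lemma cabs_rc x : cabs (rc x) = `|x|.
Proof. by rewrite /cabs /= expr0n addr0 sqrtr_sqr. Qed.

Lemma cabs0 : cabs (0 : C) = 0.
Proof. by rewrite -rc0 cabs_rc normr0. Qed.

Lemma cabs1 : cabs (1 : C) = 1.
Proof. by rewrite -rc1 cabs_rc normr1. Qed.

Lemma cabsX z n : cabs (z ^+ n) = cabs z ^+ n.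
Proof. by elim: n => [|n IH]; rewrite ?cabs1// !exprS cabsM IH. Qed.

Lemma cabs_eq0 z : cabs z = 0 -> z = 0.
Proof. by rewrite cabsE => /ComplexField.Normc.eq0_normc. Qed.

Lemma cabs_sqr z : cabs z ^+ 2 = cRe z ^+ 2 + cIm z ^+ 2.
Proof. by rewrite sqr_sqrtr// addr_ge0 ?sqr_ge0. Qed.

Lemma cabs_conj z : cabs (cconj z) = cabs z.
Proof. by rewrite /cabs /= sqrrN. Qed.

Lemma cabs_sqr_conj z : rc (cabs z ^+ 2) = z * cconj z.
Proof. by rewrite cabs_sqr; apply: ceqP; rewrite ?cReM ?cImM /=; ring. Qed.

Lemma norm_cRe z : `|cRe z| <= cabs z.
Proof. by rewrite -sqrtr_sqr ler_wsqrtr// lerDl sqr_ge0. Qed.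

Lemma norm_cIm z : `|cIm z| <= cabs z.
Proof. by rewrite -sqrtr_sqr ler_wsqrtr// lerDr sqr_ge0. Qed.

Lemma cabs_le z : cabs z <= `|cRe z| + `|cIm z|.
Proof.
rewrite -(@ler_pXn2r _ 2)// ?nnegrE ?addr_ge0 ?cabs_ge0//.
by rewrite cabs_sqr sqrrD !real_normK ?num_real// lerD2r lerDl mulrn_wge0// mulr_ge0.
Qed.

Lemma cconjM z w : cconj (z * w) = cconj z * cconj w.
Proof. by apply: ceqP; rewrite ?(cReM, cImM) /=; rewrite ?(cReM, cImM) /=; ring. Qed.

Lemma cconjB z w : cconj (z - w) = cconj z - cconj w.
Proof. by case: z; case: w => *; apply: ceqP => //=; rewrite opprD. Qed.

Lemma cconjK z : cconj (cconj z) = z.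
Proof. by case: z => *; apply: ceqP => //=; rewrite opprK. Qed.

Lemma expi0 : expi 0 = 1 :> C.
Proof. by rewrite /expi cos0 sin0. Qed.

Lemma expiD x y : expi (x + y) = expi x * expi y.
Proof. by apply: ceqP; rewrite ?(cReM, cImM) /= (cosD, sinD)//; ring. Qed.

Lemma expiN x : expi (- x) = cconj (expi x).
Proof. by rewrite /expi cosN sinN. Qed.

Lemma expiMn (n : nat) x : expi (n%:R * x) = expi x ^+ n.
Proof.
elim: n => [|n IH]; first by rewrite mul0r expi0.
by rewrite -natr1 mulrDl mul1r expiD IH exprSr.
Qed.

Lemma cabs_expi x : cabs (expi x) = 1.
Proof. by rewrite /cabs /= cos2Dsin2 sqrtr1. Qed.

Definition cbmeas F := bmeas (fun t => cRe (F t)) /\ bmeas (fun t => cIm (F t)).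

Definition cintT F : C := cmk (intT (fun t => cRe (F t))) (intT (fun t => cIm (F t))).

Lemma cbmeas_cst c : cbmeas (fun=> c).
Proof. by split; exact: bmeas_cst. Qed.

Lemma eq_cbmeas F G : F =1 G -> cbmeas F -> cbmeas G.
Proof. by move=> /funext ->. Qed.

Lemma cbmeasD F G : cbmeas F -> cbmeas G -> cbmeas (fun t => F t + G t).
Proof.
move=> [F1 F2] [G1 G2]; split.
  by apply: eq_bmeas (bmeasD F1 G1) => t; rewrite cReD.
by apply: eq_bmeas (bmeasD F2 G2) => t; rewrite cImD.
Qed.

Lemma cbmeasM F G : cbmeas F -> cbmeas G -> cbmeas (fun t => F t * G t).
Proof.
move=> [F1 F2] [G1 G2]; split.
  by apply: eq_bmeas (bmeasB (bmeasM F1 G1) (bmeasM F2 G2)) => t; rewrite cReM.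
by apply: eq_bmeas (bmeasD (bmeasM F1 G2) (bmeasM F2 G1)) => t; rewrite cImM.
Qed.

Lemma cbmeasZ c F : cbmeas F -> cbmeas (fun t => c * F t).
Proof. by move=> ?; apply: cbmeasM => //; exact: cbmeas_cst. Qed.

Lemma cbmeasB F G : cbmeas F -> cbmeas G -> cbmeas (fun t => F t - G t).
Proof.
move=> bF bG; apply: eq_cbmeas (cbmeasD bF (cbmeasZ (-1) bG)) => t.
by rewrite mulN1r.
Qed.

Lemma cbmeas_rc (f : R -> R) : bmeas f -> cbmeas (fun t => rc (f t)).
Proof. by move=> bf; split => //; exact: bmeas_cst. Qed.

Lemma cbmeas_sum (I : Type) (s : seq I) (F : I -> R -> C) :
  (forall i, cbmeas (F i)) -> cbmeas (fun t => \sum_(i <- s) F i t).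
Proof.
move=> bF; elim: s => [|i s IH].
  by apply: eq_cbmeas (cbmeas_cst 0) => t; rewrite big_nil.
by apply: eq_cbmeas (cbmeasD (bF i) IH) => t; rewrite big_cons.
Qed.

Lemma cbmeas_expi r : cbmeas (fun t => expi (r * t)).
Proof.
by split; apply: bmeas_continuous; [exact: continuous_cosM|exact: continuous_sinM].
Qed.

Lemma cbmeas_expi1 : cbmeas (@expi R).
Proof. by apply: eq_cbmeas (cbmeas_expi 1) => t; rewrite mul1r. Qed.

Lemma cbmeas_exp F n : cbmeas F -> cbmeas (fun t => F t ^+ n).
Proof.
move=> bF; elim: n => [|n IH]; first by exact: (cbmeas_cst 1).
by apply: eq_cbmeas (cbmeasM bF IH) => t; rewrite exprS.
Qed.

Lemma cbmeas_horner (p : {poly C}) : cbmeas (fun t => p.[expi t]).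
Proof.
have bs : cbmeas (fun t => \sum_(i < size p) p`_i * expi t ^+ i).
  by apply: cbmeas_sum => i; apply: cbmeasZ; apply: cbmeas_exp; exact: cbmeas_expi1.
by apply: eq_cbmeas bs => t; rewrite horner_coef.
Qed.

Lemma bmeas_cabs F : cbmeas F -> bmeas (fun t => cabs (F t)).
Proof.
move=> [F1 F2]; split.
  apply: (@measurableT_comp _ _ _ _ _ _ (@Num.sqrt R)).
    by apply: continuous_measurable_fun; exact: sqrt_continuous.
  by apply: measurable_funD; apply: measurable_funX; [case: F1|case: F2].
case: F1 F2 => _ [M FM] [_ [N FN]]; exists (M + N) => t Tt.
by rewrite ger0_norm ?cabs_ge0// (le_trans (cabs_le _))// lerD ?FM ?FN.
Qed.

Lemma cbmeas_bounded F : cbmeas F ->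
  exists M, 0 <= M /\ forall t, T t -> cabs (F t) <= M.
Proof.
move=> /bmeas_cabs[_ [M FM]]; exists `|M|; split => // t /FM.
by rewrite ger0_norm ?cabs_ge0// => /le_trans; apply; exact: ler_norm.
Qed.

Lemma eq_cintT F G : (forall t, T t -> F t = G t) -> cintT F = cintT G.
Proof. by move=> FG; congr cmk; apply: eq_intT => t /FG ->. Qed.

Lemma cintTD F G : cbmeas F -> cbmeas G ->
  cintT (fun t => F t + G t) = cintT F + cintT G.
Proof.
move=> [F1 F2] [G1 G2]; apply: ceqP; rewrite ?cReD ?cImD /= -intTD//.
  by apply: eq_intT => t _; rewrite cReD.
by apply: eq_intT => t _; rewrite cImD.
Qed.

Lemma cintTZ c F : cbmeas F -> cintT (fun t => c * F t) = c * cintT F.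
Proof.
move=> [F1 F2]; apply: ceqP; rewrite ?cReM ?cImM /= -!intTZ//.
  by rewrite -intTB; [apply: eq_intT => t _; rewrite cReM|exact: bmeasZ..].
by rewrite -intTD; [apply: eq_intT => t _; rewrite cImM|exact: bmeasZ..].
Qed.

Lemma cintTB F G : cbmeas F -> cbmeas G ->
  cintT (fun t => F t - G t) = cintT F - cintT G.
Proof.
move=> bF bG; rewrite -[RHS]/(_ + - _) -mulN1r -cintTZ// -cintTD//.
  by apply: eq_cintT => t _; rewrite mulN1r.
exact: cbmeasZ.
Qed.

Lemma cintT_rc (f : R -> R) : cintT (fun t => rc (f t)) = rc (intT f).
Proof. by apply: ceqP => //=; rewrite intT_cst mulr0. Qed.

Lemma cintT_sum (I : Type) (s : seq I) (F : I -> R -> C) :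
  (forall i, cbmeas (F i)) ->
  cintT (fun t => \sum_(i <- s) F i t) = \sum_(i <- s) cintT (F i).
Proof.
move=> bF; elim: s => [|i s IH].
  rewrite big_nil -rc0 -[in RHS](mulr0 (2 * pi)) -intT_cst -cintT_rc.
  by apply: eq_cintT => t _; rewrite big_nil.
rewrite big_cons -IH -cintTD//; last exact: cbmeas_sum.
by apply: eq_cintT => t _; rewrite big_cons.
Qed.

(** The real and imaginary parts are estimated separately, whence the factor 2. It is harmless,
    since every use tolerates a constant factor. *)
Lemma cabs_cintT F : cbmeas F -> cabs (cintT F) <= 2 * intT (fun t => cabs (F t)).
Proof.
move=> bF; have bA := bmeas_cabs bF; case: bF => F1 F2.
rewrite (le_trans (cabs_le _))//= mulrDl !mul1r lerD//.
  apply: (le_trans (intT_norm F1)); apply: le_intT => //.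
    exact: bmeas_norm.
  by move=> t _; exact: norm_cRe.
apply: (le_trans (intT_norm F2)); apply: le_intT => //.
  exact: bmeas_norm.
by move=> t _; exact: norm_cIm.
Qed.

Lemma cintT_expi (n : int) :
  cintT (fun t => expi (n%:~R * t)) = rc (2 * pi * (n == 0)%:R).
Proof. by apply: ceqP => /=; rewrite ?intT_cos ?intT_sin. Qed.

End complex_bounded_measurable.

(** * The algebra of bounded L^1-limits of polynomials in [expi t] *)

Section analytic_approx.
Context {R : realType}.
Local Notation C := (complex.complex R).
Local Notation T := (@Tdom R).
Implicit Types (F G : R -> C) (p q : {poly C}) (t : R).

(** L^1 approximation is enough because, for fixed [rho], the Poisson kernel is bounded. *)
Definition analytic_approx F := cbmeas F /\
  forall e : R, 0 < e ->
  exists p : {poly C}, intT (fun t => cabs (F t - p.[expi t])) <= e.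

Lemma bmeas_dist F G : cbmeas F -> cbmeas G -> bmeas (fun t => cabs (F t - G t)).
Proof. by move=> bF bG; apply: bmeas_cabs; exact: cbmeasB. Qed.

Lemma analytic_approx_horner p : analytic_approx (fun t => p.[expi t]).
Proof.
split; first exact: cbmeas_horner.
move=> e e0; exists p; rewrite (_ : intT _ = 0) ?ltW//.
rewrite -[RHS](mulr0 (2 * pi)) -intT_cst; apply: eq_intT => t _.
by rewrite subrr cabs0.
Qed.

Lemma analytic_approx_cst (c : C) : analytic_approx (fun=> c).
Proof.
have := analytic_approx_horner c%:P; congr analytic_approx.
by apply/funext => t; rewrite hornerC.
Qed.

Lemma analytic_approxB F G : analytic_approx F -> analytic_approx G ->
  analytic_approx (fun t => F t - G t).
Proof.
move=> [bF aF] [bG aG]; split; first exact: cbmeasB.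
move=> e e0; have e20 : 0 < e / 2 by rewrite divr_gt0.
have [p Fp] := aF _ e20; have [q Gq] := aG _ e20.
exists (p - q); rewrite [e]splitr (le_trans _ (lerD Fp Gq))//.
have bp := cbmeas_horner p; have bq := cbmeas_horner q.
rewrite -intTD; try exact: bmeas_dist.
apply: le_intT.
- apply: bmeas_dist; [exact: cbmeasB|exact: cbmeas_horner].
- by apply: bmeasD; exact: bmeas_dist.
- move=> t _; rewrite hornerD hornerN.
  have -> : F t - G t - (p.[expi t] - q.[expi t]) =
    (F t - p.[expi t]) - (G t - q.[expi t]) by ring.
  exact: le_cabsB.
Qed.

Lemma analytic_approxM F G : analytic_approx F -> analytic_approx G ->
  analytic_approx (fun t => F t * G t).
Proof.
move=> [bF aF] [bG aG]; split; first exact: cbmeasM.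
move=> e e0; have e20 : 0 < e / 2 by rewrite divr_gt0.
have [M [M0 GM]] := cbmeas_bounded bG.
have M10 : 0 < M + 1 by rewrite ltr_wpDl.
have [p Fp] := aF _ (divr_gt0 e20 M10).
have bp := cbmeas_horner p.
(* The approximants carry no common bound: the accuracy required of [q] depends on the bound [N] of
   [p], so [q] is chosen after [p]. *)
have [N [N0 pN]] := cbmeas_bounded bp.
have N10 : 0 < N + 1 by rewrite ltr_wpDl.
have [q Gq] := aG _ (divr_gt0 e20 N10).
have bq := cbmeas_horner q.
exists (p * q).
move: Fp Gq; rewrite ler_pdivlMr// => Fp; rewrite ler_pdivlMr// => Gq.
rewrite [e]splitr (le_trans _ (lerD Fp Gq))//.
rewrite ![intT _ * _]mulrC -!intTZ; try exact: bmeas_dist.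
rewrite -intTD; try by apply: bmeasZ; exact: bmeas_dist.
apply: le_intT.
- apply: bmeas_dist; [exact: cbmeasM|exact: cbmeas_horner].
- by apply: bmeasD; apply: bmeasZ; exact: bmeas_dist.
- move=> t Tt; rewrite hornerM.
  have -> : F t * G t - p.[expi t] * q.[expi t] =
    G t * (F t - p.[expi t]) + p.[expi t] * (G t - q.[expi t]) by ring.
  apply: (le_trans (le_cabsD _ _)); rewrite !cabsM.
  by rewrite lerD// ler_wpM2r ?cabs_ge0// ler_wpDr// ?GM ?pN.
Qed.

Lemma analytic_approxX F n : analytic_approx F -> analytic_approx (fun t => F t ^+ n).
Proof.
move=> aF; elim: n => [|n IH]; first exact: (analytic_approx_cst 1).
have := analytic_approxM aF IH; congr analytic_approx.
by apply/funext => t; rewrite exprS.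
Qed.

End analytic_approx.

(** * The Poisson integral at a point of the radius, and its multiplicativity *)

Section poisson.
Context {R : realType}.
Local Notation C := (complex.complex R).
Local Notation T := (@Tdom R).
Implicit Types (F G : R -> C) (p q : {poly C}) (t : R).

(** This is the squared modulus of [1 - rho * expi t]. *)
Definition poisson_den (rho t : R) := 1 - 2 * rho * cos t + rho ^+ 2.

Definition poisson_kernel (rho t : R) := (1 - rho ^+ 2) / poisson_den rho t.

Definition poisson (rho : R) F : C :=
  rc (2 * pi)^-1 * cintT (fun t => rc (poisson_kernel rho t) * F t).

Variable rho : R.
Hypothesis rho01 : 0 <= rho < 1.

Let rho0 : 0 <= rho. Proof. by case/andP: rho01. Qed.
Let rho1 : rho < 1. Proof. by case/andP: rho01. Qed.

Local Notation P := (poisson_kernel rho).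
Local Notation A := (poisson rho).

Lemma poisson_den_gt0 t : 0 < poisson_den rho t.
Proof.
rewrite /poisson_den.
have -> : 1 - 2 * rho * cos t + rho ^+ 2 = (1 - rho) ^+ 2 + 2 * rho * (1 - cos t) by ring.
rewrite ltr_pwDl//; first by rewrite exprn_gt0// subr_gt0.
by rewrite mulr_ge0 ?subr_ge0 ?cos_le1// mulr_ge0.
Qed.

Lemma poisson_kernel_ge0 t : 0 <= P t.
Proof.
rewrite divr_ge0 ?ltW ?poisson_den_gt0// subr_gt0.
by rewrite exprn_ilt1.
Qed.

Lemma bmeas_poisson_denV : bmeas (fun t => (poisson_den rho t)^-1).
Proof.
apply: bmeas_continuous => x; apply: cvgV; first by rewrite gt_eqF ?poisson_den_gt0.
apply: cvgD; last exact: cvg_cst.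
apply: cvgB; first exact: cvg_cst.
by apply: cvgM; [exact: cvg_cst|exact: continuous_cos].
Qed.

Lemma bmeas_poisson_kernel : bmeas P.
Proof. by apply: bmeasZ; exact: bmeas_poisson_denV. Qed.

Let cbP : cbmeas (fun t => rc (P t)).
Proof. by apply: cbmeas_rc; exact: bmeas_poisson_kernel. Qed.

Let cbPM F : cbmeas F -> cbmeas (fun t => rc (P t) * F t).
Proof. by move=> bF; apply: cbmeasM. Qed.

(** The function [1 / (1 - rho * expi t)], with its denominator made real. Its moments replace a
    power series expansion of the Poisson kernel. *)
Let cauchy_kernel t : C := cmk ((1 - rho * cos t) * (poisson_den rho t)^-1)
  (rho * sin t * (poisson_den rho t)^-1).
Local Notation Q := cauchy_kernel.

Let cauchy_kernelE t : Q t * (1 - rc rho * expi t) = 1.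
Proof.
have h : poisson_den rho t != 0 by rewrite gt_eqF ?poisson_den_gt0.
have cs := cos2Dsin2 t.
apply: ceqP; rewrite ?(cReM, cImM) /= ?(cReD, cImD, cReN, cImN) ?(cRe_rcM, cIm_rcM) /=; last by field.
transitivity ((1 - 2 * rho * cos t + rho ^+ 2 * (cos t ^+ 2 + sin t ^+ 2)) /
    poisson_den rho t); first by field.
by rewrite cs mulr1 divff.
Qed.

Let cbQ : cbmeas Q.
Proof.
have bc : bmeas (@cos R) by case: (@cbmeas_expi1 R).
have bs : bmeas (@sin R) by case: (@cbmeas_expi1 R).
split; apply: bmeasM; try exact: bmeas_poisson_denV.
  by apply: bmeasB; [exact: bmeas_cst|exact: bmeasZ].
exact: bmeasZ.
Qed.

Let cbX n : cbmeas (fun t => expi t ^+ n).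
Proof. by apply: cbmeas_exp; exact: cbmeas_expi1. Qed.

Let cintT_expiX n : cintT (fun t => expi t ^+ n) = rc (2 * pi * (n == 0)%:R).
Proof.
rewrite -[(n == 0)%N]/(n == 0 :> int) -cintT_expi; apply: eq_cintT => t _.
by rewrite -expiMn.
Qed.

(* The bounded sequence [J n] of these integrals satisfies [J n = rho * J n.+1],
   so that [J 1 = rho ^ k * J k.+1] tends to 0. *)
Let cauchy_moment n : cintT (fun t => expi t ^+ n.+1 * Q t) = 0.
Proof.
have bJ k : cbmeas (fun t => expi t ^+ k * Q t) by apply: cbmeasM.
set J := fun k => cintT (fun t => expi t ^+ k * Q t).
have JS k : J k.+1 = rc rho * J k.+2.
  rewrite /J -cintTZ//; apply/subr0_eq; rewrite -cintTB//; last exact: cbmeasZ.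
  transitivity (cintT (fun t => expi t ^+ k.+1)); last first.
    by rewrite cintT_expiX/= mulr0.
  apply: eq_cintT => t _; rewrite -[RHS]mulr1 -(cauchy_kernelE t) [in X in _ - X]exprSr.
  ring.
have Jm k : J n.+1 = rc (rho ^+ k) * J (n + k).+1.
  elim: k => [|k IH]; first by rewrite expr0 mul1r addn0.
  by rewrite IH JS exprSr rcM -mulrA addnS.
have [M [M0 QM]] := cbmeas_bounded cbQ.
have JM k : cabs (J k) <= 2 * (2 * pi * M).
  rewrite -intT_cst (le_trans (cabs_cintT (bJ k)))// ler_pM2l//.
  apply: le_intT; [exact: bmeas_cabs|exact: bmeas_cst|move=> t Tt].
  by rewrite cabsM cabsX cabs_expi expr1n mul1r QM.
apply: cabs_eq0; apply/eqP; rewrite eq_le cabs_ge0 andbT -/(J n.+1).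
have cv : (fun k => rho ^+ k * (2 * (2 * pi * M))) @ \oo --> (0 : R).
  rewrite -[X in _ --> X](mul0r (2 * (2 * pi * M))); apply: cvgMr_tmp.
  by apply: cvg_expr; rewrite ger0_norm.
apply: (ler_cvg_to (cvg_cst (cabs (J n.+1))) cv).
near=> k; rewrite (Jm k) cabsM cabs_rc ger0_norm ?exprn_ge0//.
by rewrite ler_wpM2l// exprn_ge0.
Unshelve. all: by end_near. Qed.

Let poisson_moment0 : A (fun=> 1) = 1.
Proof.
suff e : intT P = 2 * pi.
  rewrite /poisson; under eq_fun do rewrite mulr1.
  by rewrite cintT_rc e -rcM mulVf ?rc1// pi2_neq0.
(* With [z = expi t], the kernel [P] is the real part of [(1 + rho z) / (1 - rho z) = 1 + 2 rho z
   Q], and the moment of [z Q] vanishes. *)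
have -> : intT P = cRe (cintT (fun t => 1 + rc (2 * rho) * (expi t ^+ 1 * Q t))).
  apply: eq_intT => t _; rewrite cReD cRe_rcM cReM expr1/= /poisson_kernel.
  have h : poisson_den rho t != 0 by rewrite gt_eqF ?poisson_den_gt0.
  have -> : 1 - rho ^+ 2 = poisson_den rho t + 2 * rho * (cos t - rho * (cos t ^+ 2 + sin t ^+ 2)).
    by rewrite cos2Dsin2 /poisson_den; ring.
  by field.
rewrite cintTD; [|exact: cbmeas_cst|by apply: cbmeasZ; apply: cbmeasM].
rewrite cintTZ; last by apply: cbmeasM.
by rewrite cauchy_moment mulr0 addr0 -[1]rc1 cintT_rc intT_cst mulr1.
Qed.

Lemma poissonB F G : cbmeas F -> cbmeas G -> A (fun t => F t - G t) = A F - A G.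
Proof.
move=> bF bG; rewrite /poisson -mulrBr -cintTB; [|exact: cbPM..].
by congr (_ * _); apply: eq_cintT => t _; rewrite mulrBr.
Qed.

Lemma poissonZ c F : cbmeas F -> A (fun t => c * F t) = c * A F.
Proof.
move=> bF; rewrite /poisson [RHS]mulrCA -(cintTZ c); last exact: cbPM.
by congr (_ * _); apply: eq_cintT => t _; rewrite mulrCA.
Qed.

Lemma poisson_sum (I : Type) (s : seq I) (F : I -> R -> C) :
  (forall i, cbmeas (F i)) ->
  A (fun t => \sum_(i <- s) F i t) = \sum_(i <- s) A (F i).
Proof.
move=> bF; rewrite /poisson -mulr_sumr -cintT_sum; last by move=> i; exact: cbPM.
by congr (_ * _); apply: eq_cintT => t _; rewrite mulr_sumr.
Qed.

(** With [z = expi t] one has [z - rho = z (1 - rho conj z)], and the denominator of [P] is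
    [(1 - rho z) (1 - rho conj z)]. Hence [(z - rho) P = (1 - rho^2) z Q], and consecutive moments
    differ by the factor [rho] because the Cauchy moments vanish. *)
Lemma poisson_moment n : A (fun t => expi t ^+ n) = rc rho ^+ n.
Proof.
elim: n => [|n IH]; first by rewrite poisson_moment0.
rewrite exprS -IH -poissonZ//; apply/subr0_eq; rewrite -poissonB//; last exact: cbmeasZ.
transitivity (rc (2 * pi)^-1 * (rc (1 - rho ^+ 2) * cintT (fun t => expi t ^+ n.+1 * Q t))).
  rewrite -cintTZ; last exact: cbmeasM.
  congr (_ * _); apply: eq_cintT => t _; rewrite exprS -mulrBl.
  have -> : rc (1 - rho ^+ 2) * (expi t * expi t ^+ n * Q t) =
     (rc (1 - rho ^+ 2) * expi t * Q t) * expi t ^+ n by ring.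
  rewrite mulrA; congr (_ * _).
  have h : poisson_den rho t != 0 by rewrite gt_eqF ?poisson_den_gt0.
  rewrite /poisson_kernel.
  apply: ceqP; rewrite -?mulrA ?(cRe_rcM, cIm_rcM) -?mulrA; congr (_ * _);
    rewrite ?(cReM, cImM, cReD, cImD, cReN, cImN) /=.
    have -> : (poisson_den rho t)^-1 * (cos t - rho) = (poisson_den rho t)^-1 *
       (cos t - rho * (cos t ^+ 2 + sin t ^+ 2)) by rewrite cos2Dsin2 mulr1.
    ring.
  ring.
by rewrite cauchy_moment !mulr0.
Qed.

Lemma poisson_horner p : A (fun t => p.[expi t]) = p.[rc rho].
Proof.
under eq_fun do rewrite horner_coef.
rewrite horner_coef poisson_sum; last by move=> i; exact: cbmeasZ.
by apply: eq_bigr => i _; rewrite poissonZ// poisson_moment.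
Qed.

Lemma poisson_cst (c : C) : A (fun=> c) = c.
Proof. by have := poisson_horner c%:P; under eq_fun do rewrite hornerC; rewrite hornerC. Qed.

(** Continuity in L^1 for fixed [rho]: here [K] depends on [rho], which is enough to pass to limits
    of polynomials. *)
Lemma poisson_bound : exists2 K, 0 <= K &
  forall F, cbmeas F -> cabs (A F) <= K * intT (fun t => cabs (F t)).
Proof.
have [M [M0 PM]] := cbmeas_bounded cbP.
exists ((2 * pi)^-1 * (2 * M)).
  by apply: mulr_ge0; [rewrite invr_ge0 ltW// pi2_gt0|exact: mulr_ge0].
move=> F bF; rewrite cabsM cabs_rc gtr0_norm ?invr_gt0 ?pi2_gt0//.
rewrite -!mulrA ler_pM2l ?invr_gt0 ?pi2_gt0//.
have bPF : cbmeas (fun t => rc (P t) * F t) by exact: cbPM.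
rewrite (le_trans (cabs_cintT bPF))// ler_pM2l// -intTZ; last exact: bmeas_cabs.
apply: le_intT; [exact: bmeas_cabs|by apply: bmeasZ; exact: bmeas_cabs|move=> t Tt].
by rewrite cabsM ler_wpM2r ?cabs_ge0 ?PM.
Qed.

(** Only [F] is approximated, so [G] need only be bounded. By the hypothesis on [p * G], the defect
    of multiplicativity for [F] equals the one for [F - p], which is small in L^1. *)
Lemma poissonM_analytic F G : analytic_approx F -> cbmeas G ->
  (forall p, A (fun t => p.[expi t] * G t) = p.[rc rho] * A G) ->
  A (fun t => F t * G t) = A F * A G.
Proof.
move=> [bF aF] bG pG; have [K K0 AK] := poisson_bound.
have [M [M0 GM]] := cbmeas_bounded bG.
apply/subr0_eq/cabs_eq0/eqP; rewrite eq_le cabs_ge0 andbT.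
apply/ler_addgt0Pl => e e0; rewrite addr0.
set L := K * M + K * cabs (A G).
have L0 : 0 <= L by rewrite addr_ge0// mulr_ge0 ?cabs_ge0.
have L10 : 0 < L + 1 by rewrite ltr_wpDl.
have [p Fp] := aF _ (divr_gt0 e0 L10).
have bp := cbmeas_horner p.
have bFp := cbmeasB bF bp.
have -> : A (fun t => F t * G t) - A F * A G =
    A (fun t => (F t - p.[expi t]) * G t) - A (fun t => F t - p.[expi t]) * A G.
  rewrite poissonB// poisson_horner.
  have -> : A (fun t => (F t - p.[expi t]) * G t) =
      A (fun t => F t * G t) - A (fun t => p.[expi t] * G t).
    by rewrite -poissonB; [under eq_fun do rewrite mulrBl|exact: cbmeasM..].
  by rewrite pG; ring.
rewrite (le_trans (le_cabsB _ _))// cabsM.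
have h1 : cabs (A (fun t => (F t - p.[expi t]) * G t)) <=
    K * M * intT (fun t => cabs (F t - p.[expi t])).
  apply: (le_trans (AK _ _)); first exact: cbmeasM.
  rewrite -mulrA ler_wpM2l// -intTZ; last exact: bmeas_cabs.
  apply: le_intT.
  - by apply: bmeas_cabs; exact: cbmeasM.
  - by apply: bmeasZ; exact: bmeas_cabs.
  - by move=> t Tt; rewrite cabsM mulrC ler_wpM2r ?cabs_ge0 ?GM.
have h2 : cabs (A (fun t => F t - p.[expi t])) * cabs (A G) <=
    K * cabs (A G) * intT (fun t => cabs (F t - p.[expi t])).
  by rewrite mulrAC ler_wpM2r ?cabs_ge0// AK.
rewrite (le_trans (lerD h1 h2))// -mulrDl -/L.
move: Fp; rewrite ler_pdivlMr// mulrC; apply: le_trans.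
by rewrite ler_wpM2r ?lerDl// intT_ge0// => t _; exact: cabs_ge0.
Qed.

(** The extension lemma is used twice: for [G] against a polynomial, which supplies its hypothesis,
    and then for [F] against [G]. *)
Lemma poissonM F G : analytic_approx F -> analytic_approx G ->
  A (fun t => F t * G t) = A F * A G.
Proof.
move=> aF aG; have [bG _] := aG.
apply: poissonM_analytic => // p; rewrite -poisson_horner mulrC.
under eq_fun do rewrite mulrC.
apply: poissonM_analytic => //; first exact: cbmeas_horner.
move=> q; rewrite !poisson_horner -hornerM -poisson_horner.
by under [in RHS]eq_fun do rewrite hornerM.
Qed.

End poisson.

(** * Fejer means and their convergence in L^1 *)

Section fejer.
Context {R : realType}.
Local Notation C := (complex.complex R).
Local Notation T := (@Tdom R).
Local Notation leb := (@lebesgue_measure R).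
Implicit Types (F G : R -> C) (w h : R -> R) (t s x : R) (N : nat).

Definition dirichlet N x : C := \sum_(k < N) expi x ^+ k.

(** Written as a square, the kernel is visibly nonnegative. At [N = 0] it is 0 and not of mean 1,
    hence the index [N.+1] in the statements on constants and limits. *)
Definition fejer N x : R := N%:R^-1 * cabs (dirichlet N x) ^+ 2.

Definition fejer_mean N w t : R :=
  (2 * pi)^-1 * intT (fun s => fejer N (t - s) * w s).

Lemma fejer_ge0 N x : 0 <= fejer N x.
Proof. by rewrite mulr_ge0 ?invr_ge0 ?sqr_ge0. Qed.

(** Multiplication by [expi x - 1], of squared modulus [2 * (1 - cos x)], telescopes the geometric
    sum to [expi x ^+ N - 1], of modulus at most 2. The product form avoids dividing by
    [1 - cos x]. *)
Lemma fejer_cos_le N x : fejer N x * (1 - cos x) <= 2 / N%:R.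
Proof.
rewrite /fejer mulrAC -mulrA mulrC ler_wpM2r ?invr_ge0//.
have e1 : cabs (expi x - 1) ^+ 2 = 2 * (1 - cos x).
  rewrite cabs_sqr /expi/= subr0.
  transitivity (cos x ^+ 2 + sin x ^+ 2 + 1 - 2 * cos x); first by ring.
  by rewrite cos2Dsin2; ring.
have : cabs (expi x ^+ N - 1) ^+ 2 <= 2 ^+ 2.
  rewrite ler_pXn2r ?nnegrE ?cabs_ge0// (le_trans (le_cabsB _ _))//.
  by rewrite cabsX cabs_expi expr1n cabs1.
by rewrite subrX1 -/(dirichlet N x) cabsM exprMn e1 => ?; lra.
Qed.

Lemma cconj_dirichlet N x : cconj (dirichlet N x) = dirichlet N (- x).
Proof.
have cX k : cconj (expi x ^+ k) = expi (- x) ^+ k.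
  elim: k => [|k IH]; last by rewrite !exprS cconjM IH expiN.
  by apply: ceqP => //=; rewrite oppr0.
rewrite /dirichlet; elim: N => [|N IH].
  by rewrite !big_ord0; apply: ceqP => //=; rewrite oppr0.
rewrite !big_ord_recr/= -IH -cX; apply: ceqP; rewrite /= ?cReD ?cImD//=.
by rewrite opprD.
Qed.

(** Left as a double sum: the terms are not collected by the value of [j - k], so the weights
    [1 - |n| / N] never appear. *)
Lemma fejerE N x : rc (fejer N x) = rc N%:R^-1 *
  \sum_(j < N) \sum_(k < N) expi ((j%:Z - k%:Z)%:~R * x).
Proof.
rewrite /fejer rcM; congr (_ * _).
rewrite cabs_sqr_conj cconj_dirichlet big_distrl/=; apply: eq_bigr => j _.
rewrite big_distrr/=; apply: eq_bigr => k _.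
by rewrite -!expiMn -expiD mulrN -mulrBl intrB.
Qed.

Lemma cbmeas_fejer N t : cbmeas (fun s => rc (fejer N (t - s))).
Proof.
under eq_fun do rewrite fejerE.
apply: cbmeasZ; apply: cbmeas_sum => j; apply: cbmeas_sum => k.
under eq_fun do rewrite mulrBr expiD -mulNr.
by apply: cbmeasZ; exact: cbmeas_expi.
Qed.

Lemma bmeas_fejer N t : bmeas (fun s => fejer N (t - s)).
Proof. by case: (cbmeas_fejer N t). Qed.

Lemma fourier_coefE F (n : int) :
  fourier_coef F n = rc (2 * pi)^-1 * cintT (fun t => F t * expi (- (n%:~R * t))).
Proof. by apply: ceqP; rewrite ?(cRe_rcM, cIm_rcM). Qed.

Lemma fejer_meanE N F t : cbmeas F ->
  cmk (fejer_mean N (fun s => cRe (F s)) t) (fejer_mean N (fun s => cIm (F s)) t) =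
  rc N%:R^-1 * \sum_(j < N) \sum_(k < N)
    fourier_coef F (j%:Z - k%:Z) * expi ((j%:Z - k%:Z)%:~R * t).
Proof.
move=> bF.
transitivity (rc (2 * pi)^-1 * cintT (fun s => rc (fejer N (t - s)) * F s)).
  apply: ceqP; rewrite ?(cRe_rcM, cIm_rcM)/=; congr (_ * _); apply: eq_intT => s _;
  by rewrite ?(cRe_rcM, cIm_rcM).
have bFe (n : int) : cbmeas (fun s => F s * expi (- (n%:~R * s))).
  apply: cbmeasM => //; under eq_fun do rewrite -mulNr.
  exact: cbmeas_expi.
transitivity (rc (2 * pi)^-1 * cintT (fun s => rc N%:R^-1 *
    \sum_(j < N) \sum_(k < N) expi ((j%:Z - k%:Z)%:~R * t) *
       (F s * expi (- ((j%:Z - k%:Z)%:~R * s))))).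
  congr (_ * _); apply: eq_cintT => s _; rewrite fejerE -mulrA; congr (_ * _).
  rewrite big_distrl/=; apply: eq_bigr => j _; rewrite big_distrl/=; apply: eq_bigr => k _.
  by rewrite mulrBr expiD -mulrA [F s * _]mulrC.
rewrite cintTZ; last first.
  by apply: cbmeas_sum => j; apply: cbmeas_sum => k; exact: cbmeasZ.
rewrite mulrCA; congr (_ * _).
rewrite cintT_sum; last by move=> j; apply: cbmeas_sum => k; exact: cbmeasZ.
rewrite big_distrr/=; apply: eq_bigr => j _.
rewrite cintT_sum; last by move=> k; exact: cbmeasZ.
rewrite big_distrr/=; apply: eq_bigr => k _.
by rewrite cintTZ// fourier_coefE mulrCA mulrC.
Qed.

Lemma fejer_mean_realE N w t : bmeas w ->
  rc (fejer_mean N w t) = rc N%:R^-1 * \sum_(j < N) \sum_(k < N)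
    fourier_coef (fun s => rc (w s)) (j%:Z - k%:Z) * expi ((j%:Z - k%:Z)%:~R * t).
Proof.
move=> bw; rewrite -fejer_meanE; last exact: cbmeas_rc.
apply: ceqP => //=; rewrite /fejer_mean (_ : intT _ = 0) ?mulr0//.
by rewrite -[RHS](mulr0 (2 * pi)) -intT_cst; apply: eq_intT => s _; rewrite mulr0.
Qed.

Lemma bmeas_fejer_mean N w : bmeas w -> bmeas (fejer_mean N w).
Proof.
move=> bw; have : cbmeas (fun t => rc (fejer_mean N w t)).
  under eq_fun do rewrite fejer_mean_realE//.
  apply: cbmeasZ; apply: cbmeas_sum => j; apply: cbmeas_sum => k.
  by apply: cbmeasZ; exact: cbmeas_expi.
by case.
Qed.

Lemma sum_diag N (c : C) : \sum_(j < N.+1) \sum_(k < N.+1)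
  c * rc (j%:Z - k%:Z == 0)%:R = rc N.+1%:R * c.
Proof.
transitivity (\sum_(j < N.+1) c).
  apply: eq_bigr => j _; rewrite (bigD1 j)//= subrr eqxx rc1 mulr1 big1 ?addr0//.
  move=> k kj; rewrite subr_eq0 (_ : (_ == _) = false) ?mulr0//.
  by apply/negbTE; rewrite eqz_nat eq_sym.
by rewrite sumr_const card_ord -[c *+ _]mulr_natl /rc rmorph_nat.
Qed.

Lemma fejer_mean_cst N x t : fejer_mean N.+1 (fun=> x) t = x.
Proof.
apply: (@complexI R); rewrite -[LHS]/(rc _) -[RHS]/(rc _).
rewrite fejer_mean_realE; last exact: bmeas_cst.
transitivity (rc N.+1%:R^-1 * (\sum_(j < N.+1) \sum_(k < N.+1)
  rc x * rc (j%:Z - k%:Z == 0)%:R)); last first.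
  by rewrite sum_diag mulrA -rcM mulVf ?mul1r// pnatr_eq0.
congr (_ * _); apply: eq_bigr => j _; apply: eq_bigr => k _.
rewrite fourier_coefE cintTZ; last first.
  by under eq_fun do rewrite -mulNr; exact: cbmeas_expi.
under eq_fun do rewrite -mulNr -mulrNz.
rewrite cintT_expi oppr_eq0.
case: eqP => [->|_]; last by rewrite !mulr0 mul0r.
rewrite mul0r expi0 !mulr1 mulrCA -rcM mulVf ?pi2_neq0//.
by rewrite rc1 mulr1.
Qed.

(** Integrating the trigonometric polynomial term by term leaves only the diagonal [j = k]; no
    exchange of two integrals is involved. *)
Lemma intT_fejer_mean N w : bmeas w -> intT (fejer_mean N.+1 w) = intT w.
Proof.
move=> bw; apply: (@complexI R); rewrite -[LHS]/(rc _) -[RHS]/(rc _).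
rewrite -cintT_rc; under eq_fun do rewrite fejer_mean_realE//.
rewrite cintTZ; last first.
  apply: cbmeas_sum => j; apply: cbmeas_sum => k.
  by apply: cbmeasZ; exact: cbmeas_expi.
rewrite cintT_sum; last first.
  by move=> j; apply: cbmeas_sum => k; apply: cbmeasZ; exact: cbmeas_expi.
transitivity (rc N.+1%:R^-1 * (\sum_(j < N.+1) \sum_(k < N.+1)
  rc (intT w) * rc (j%:Z - k%:Z == 0)%:R)); last first.
  by rewrite sum_diag mulrA -rcM mulVf ?mul1r// pnatr_eq0.
congr (_ * _); apply: eq_bigr => j _.
rewrite cintT_sum; last by move=> k; apply: cbmeasZ; exact: cbmeas_expi.
apply: eq_bigr => k _.
rewrite cintTZ; last exact: cbmeas_expi.
rewrite cintT_expi; case: eqP => [->|]; last by rewrite !mulr0.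
rewrite mulr1 rc1 mulr1 fourier_coefE mulrAC -rcM mulVf ?pi2_neq0// mul1r -cintT_rc.
by apply: eq_cintT => t _; rewrite mul0r oppr0 expi0 mulr1.
Qed.

Lemma fejer_mean_le N w h t : bmeas w -> bmeas h ->
  (forall s, T s -> w s <= h s) -> fejer_mean N w t <= fejer_mean N h t.
Proof.
move=> bw bh wh; rewrite ler_pM2l ?invr_gt0 ?pi2_gt0//.
have bf := bmeas_fejer N t.
apply: le_intT; [exact: bmeasM..|move=> s Ts].
by rewrite ler_wpM2l ?fejer_ge0 ?wh.
Qed.

Lemma norm_fejer_mean N w t : bmeas w ->
  `|fejer_mean N w t| <= fejer_mean N (fun s => `|w s|) t.
Proof.
move=> bw; rewrite normrM gtr0_norm ?invr_gt0 ?pi2_gt0//.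
rewrite ler_pM2l ?invr_gt0 ?pi2_gt0//.
have bf := bmeas_fejer N t.
apply: (le_trans (intT_norm (bmeasM bf bw))); rewrite le_eqVlt; apply/orP; left; apply/eqP.
by apply: eq_intT => s _; rewrite normrM ger0_norm ?fejer_ge0.
Qed.

Lemma fejer_meanB N w h t : bmeas w -> bmeas h ->
  fejer_mean N (fun s => w s - h s) t = fejer_mean N w t - fejer_mean N h t.
Proof.
move=> bw bh; have bf := bmeas_fejer N t.
rewrite /fejer_mean -mulrBr -intTB; [|exact: bmeasM..].
by congr (_ * _); apply: eq_intT => s _; rewrite mulrBr.
Qed.

Lemma intT_norm_fejer_mean N w : bmeas w ->
  intT (fun t => `|fejer_mean N.+1 w t|) <= intT (fun t => `|w t|).
Proof.
move=> bw; have bn := bmeas_norm bw.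
rewrite -[leRHS](intT_fejer_mean N)//; apply: le_intT.
- by apply: bmeas_norm; exact: bmeas_fejer_mean.
- exact: bmeas_fejer_mean.
- by move=> t _; exact: norm_fejer_mean.
Qed.

Lemma ler_cos (x y : R) : 0 <= x -> x <= y -> y <= pi -> cos y <= cos x.
Proof.
move=> x0 xy ypi; rewrite leNgt ltr_cos ?in_itv/= ?x0 ?ypi ?(le_trans x0)//.
  by rewrite -leNgt.
exact: le_trans ypi.
Qed.

(** The two conditions keep [x] at distance at least [d] from 0 and from both points [2 * pi] and
    [- (2 * pi)]; a difference of two points of [T] can come close to all three. *)
Lemma cos_far (d x : R) : 0 <= d -> d <= `|x| -> `|x| <= 2 * pi - d -> cos x <= cos d.
Proof.
move=> d0; rewrite -(cos_norm x); move: `|x| => y dy yd.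
have [ypi|/ltW piy] := leP y pi; first exact: ler_cos.
rewrite (_ : cos y = cos (2 * pi - y)); last first.
  by rewrite mulr_natl cosB cos2pi sin2pi mul1r mul0r addr0.
by apply: ler_cos => //; lra.
Qed.

Lemma cos_lt1 (d : R) : 0 < d -> d <= pi -> cos d < 1.
Proof. by move=> d0 dpi; rewrite -cos0 ltr_cos ?in_itv/= ?lexx ?pi_ge0 ?(ltW d0). Qed.

(** The end points are excluded because [h] is continuous on the line but need not be periodic. *)
Lemma fejer_mean_cvg h t : continuous h -> `|t| < pi ->
  (fun N => fejer_mean N.+1 h t) @ \oo --> h t.
Proof.
move=> ch tpi; have bh := bmeas_continuous ch.
have [_ [M hM]] := bh.
have Tt : T t by apply/TdomE; exact: ltW.
have M0 : 0 <= M by exact: le_trans (hM t Tt).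
apply/cvgrPdist_le => e e0.
have e20 : 0 < e / 2 by rewrite divr_gt0.
have /cvgrPdist_le /(_ _ e20) := ch t.
move=> /nbhs_ballP[/= eta eta0 H].
(* The second bound gives [|t - s| <= 2 * pi - d] for every [s] in [T], as [cos_far] requires. *)
set d := Num.min eta (pi - `|t|).
have d0 : 0 < d by rewrite lt_min eta0 subr_gt0.
have dpi : d <= pi by rewrite ge_min (_ : pi - _ <= pi) ?orbT// gerBl.
have cd : 0 < 1 - cos d by rewrite subr_gt0 cos_lt1.
set K := 2 * M / (1 - cos d).
have K0 : 0 <= K by rewrite divr_ge0 ?(ltW cd)// mulr_ge0.
have hK s : T s -> `|h s - h t| <= e / 2 + K * (1 - cos (t - s)).
  move=> Ts; have [ts|ts] := ltP `|t - s| d.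
    rewrite ler_wpDr//; first by rewrite mulr_ge0// subr_ge0 cos_le1.
    by rewrite distrC; apply: H; rewrite /ball/=; apply: lt_le_trans ts _; rewrite ge_min lexx.
  rewrite ler_wpDl ?(ltW e20)// /K mulrAC ler_pdivlMr//.
  have hst : `|h s - h t| <= 2 * M.
    by rewrite (le_trans (ler_normB _ _))// mulr_natl mulr2n lerD// hM.
  rewrite (le_trans (ler_wpM2r (ltW cd) hst))// ler_wpM2l ?mulr_ge0//.
  rewrite lerD2l lerN2 cos_far ?(ltW d0)//.
  have dt : d <= pi - `|t| by rewrite ge_min lexx orbT.
  by move/TdomE : Ts => Ts; have := ler_normB t s; lra.
have bd : bmeas (fun s => h s - h t) by apply: bmeasB => //; exact: bmeas_cst.
near=> N.
rewrite distrC -[X in _ - X](fejer_mean_cst N (h t) t) -fejer_meanB//; last exact: bmeas_cst.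
apply: (le_trans (norm_fejer_mean _ _ _)) => //.
have bf := bmeas_fejer N.+1 t.
rewrite /fejer_mean -ler_pdivlMl ?invr_gt0 ?pi2_gt0// invrK.
(* The kernel has mean 1, so the two halves of [e] can be compared under the integral: [e / 2] times
   the kernel for [s] near [t], and the constant [e / 2] for the term [K * (1 - cos (t - s))],
   flattened by [fejer_cos_le]. *)
have -> : 2 * pi * e = e / 2 * intT (fun s => fejer N.+1 (t - s) * 1) + intT (fun=> e / 2).
  have := fejer_mean_cst N 1 t; rewrite /fejer_mean => /(congr1 ( *%R (2 * pi))).
  by rewrite mulrA divff ?pi2_neq0// mul1r mulr1 => ->; rewrite intT_cst; field.
have bf1 : bmeas (fun s => fejer N.+1 (t - s) * 1) by apply: bmeasM => //; exact: bmeas_cst.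
rewrite -intTZ// -intTD; [|exact: bmeasZ|exact: bmeas_cst].
apply: le_intT.
- by apply: bmeasM => //; exact: bmeas_norm.
- by apply: bmeasD; [exact: bmeasZ|exact: bmeas_cst].
- move=> s Ts; rewrite (le_trans (ler_wpM2l (fejer_ge0 _ _) (hK _ Ts)))//.
  rewrite mulrDr mulr1 [_ * (e / 2)]mulrC lerD2l mulrCA.
  rewrite (le_trans (ler_wpM2l K0 (fejer_cos_le _ _)))//.
  near: N.
  have cv : (fun N => K * (2 / N.+1%:R)) @ \oo --> (0 : R).
    rewrite -[X in _ --> X](mulr0 K); apply: cvgMl_tmp.
    rewrite -[X in _ --> X](mulr0 2); apply: cvgMl_tmp.
    exact: cvg_harmonic.
  have /cvgrPdist_le /(_ _ e20) := cv.
  apply: filterS => N; rewrite sub0r normrN; apply: le_trans; exact: ler_norm.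
Unshelve. all: by end_near. Qed.

(** Dominated convergence: the means inherit the bound [M] of [h], and pointwise convergence can
    fail only at [- pi] and [pi]. *)
Lemma fejer_mean_L1_continuous h : continuous h -> forall e, 0 < e ->
  \forall N \near \oo, intT (fun t => `|fejer_mean N.+1 h t - h t|) <= e.
Proof.
move=> ch e e0; have bh := bmeas_continuous ch.
have [_ [M hM]] := bh.
have bF N := bmeas_fejer_mean N.+1 bh.
have FM N t : `|fejer_mean N.+1 h t| <= M.
  rewrite (le_trans (norm_fejer_mean _ _ _))// -[leRHS](fejer_mean_cst N M t).
  by apply: fejer_mean_le; [exact: bmeas_norm|exact: bmeas_cst|].
have [| | | | |_ + _] := @dominated_convergence _ _ R leb T measurable_Tdom
  (fun N t => (fejer_mean N.+1 h t)%:E) (EFin \o h) (fun=> M%:E).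
- by move=> N; apply/measurable_EFinP; case: (bF N).
- by apply/measurable_EFinP; case: bh.
- exists [set - pi; pi]; split.
  + by apply: measurableU; exact: measurable_set1.
  + apply: countable_lebesgue_measure0; apply: finite_set_countable.
    exact: finite_set2.
  + move=> t /= h'; apply: contrapT => nt; apply: h' => Tt.
    apply: cvg_EFin; first exact: nearW.
    apply: fejer_mean_cvg => //; rewrite lt_neqAle; apply/andP; split; last exact/TdomE.
    apply/eqP => tpi; apply: nt; have [t0|t0] := leP 0 t.
      by right; rewrite -tpi ger0_norm.
    by left; rewrite -tpi ltr0_norm// opprK.
- exact: (bmeas_integrable (bmeas_cst M)).
- by apply: aeW => t N _; rewrite lee_fin.
- move=> /fine_cvgP[_] /cvgrPdist_le /(_ _ e0).
  apply: filterS => N /=; rewrite sub0r normrN; apply: le_trans.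
  by apply: le_trans (ler_norm _).
Qed.

(** Fejer means contract the L^1 norm, so convergence passes from continuous functions to their L^1
    limits. *)
Lemma fejer_mean_L1 w : bmeas w -> forall e, 0 < e ->
  \forall N \near \oo, intT (fun t => `|fejer_mean N.+1 w t - w t|) <= e.
Proof.
move=> bw e e0; have e30 : 0 < e / 3 by rewrite divr_gt0.
have [g_ [cg _]] := approximation_continuous_integrable measurable_Tdom
  lebesgue_Tdom_fin (bmeas_integrable bw).
move=> /fine_cvgP[_] /cvgrPdist_le /(_ _ e30)[n _] /(_ n (leqnn n)) /=.
set h := g_ n; rewrite sub0r normrN => hn.
have bh : bmeas h := bmeas_continuous (cg n).
have wh : intT (fun t => `|w t - h t|) <= e / 3 by exact: le_trans (ler_norm _) hn.
have bd := bmeasB bw bh.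
near=> N.
have bFw := bmeas_fejer_mean N.+1 bw; have bFh := bmeas_fejer_mean N.+1 bh.
have b1 := bmeas_norm (bmeas_fejer_mean N.+1 bd).
have b2 := bmeas_norm (bmeasB bFh bh); have b3 := bmeas_norm bd.
have -> : e = e / 3 + e / 3 + e / 3 by field.
apply: (@le_trans _ _ (intT (fun t => `|fejer_mean N.+1 (fun s => w s - h s) t|)
   + intT (fun t => `|fejer_mean N.+1 h t - h t|) + intT (fun t => `|w t - h t|))).
  rewrite -intTD// -intTD//; last exact: bmeasD.
  apply: le_intT; [by apply: bmeas_norm; exact: bmeasB|by do !apply: bmeasD|move=> t _].
  rewrite fejer_meanB//.
  have -> : fejer_mean N.+1 w t - w t = (fejer_mean N.+1 w t - fejer_mean N.+1 h t)
    + (fejer_mean N.+1 h t - h t) + - (w t - h t) by ring.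
  by rewrite (le_trans (ler_normD _ _))// normrN lerD2r ler_normD.
apply: lerD => //; apply: lerD.
  exact: le_trans (intT_norm_fejer_mean N bd) wh.
by near: N; exact: (fejer_mean_L1_continuous (cg n) e30).
Unshelve. all: by end_near. Qed.

Lemma fourier_analytic_approx F : cbmeas F ->
  (forall n : int, n < 0 -> fourier_coef F n = 0) -> analytic_approx F.
Proof.
move=> bF F0; split => // e e0; have e20 : 0 < e / 2 by rewrite divr_gt0.
have [b1 b2] := bF.
have [N [h1 h2]] : exists N,
    intT (fun t => `|fejer_mean N.+1 (fun s => cRe (F s)) t - cRe (F t)|) <= e / 2 /\
    intT (fun t => `|fejer_mean N.+1 (fun s => cIm (F s)) t - cIm (F t)|) <= e / 2.
  have := filterI (fejer_mean_L1 b1 e20) (fejer_mean_L1 b2 e20).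
  by move=> [N _] /(_ N (leqnn N)) H; exists N.
(* The terms with [j < k] carry coefficients of negative index, which vanish; for [k <= j] the
   truncated subtraction [j - k] is exact. *)
pose p : {poly C} := (rc N.+1%:R^-1) *: \sum_(j < N.+1) \sum_(k < N.+1 | (k <= j)%N)
  fourier_coef F (j%:Z - k%:Z) *: 'X^(j - k).
have pE t : p.[expi t] = cmk (fejer_mean N.+1 (fun s => cRe (F s)) t)
    (fejer_mean N.+1 (fun s => cIm (F s)) t).
  rewrite fejer_meanE// hornerZ; congr (_ * _); rewrite horner_sum; apply: eq_bigr => j _.
  rewrite horner_sum [LHS]big_mkcond/=; apply: eq_bigr => k _; case: leqP => kj.
    by rewrite hornerZ hornerXn -expiMn natrB// intrB.
  by rewrite F0 ?mul0r// subr_lt0.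
have bp := cbmeas_horner p.
exists p; rewrite [e]splitr (le_trans _ (lerD h1 h2))//.
have c1 : bmeas (fun t => `|fejer_mean N.+1 (fun s => cRe (F s)) t - cRe (F t)|).
  by apply: bmeas_norm; apply: bmeasB => //; exact: bmeas_fejer_mean.
have c2 : bmeas (fun t => `|fejer_mean N.+1 (fun s => cIm (F s)) t - cIm (F t)|).
  by apply: bmeas_norm; apply: bmeasB => //; exact: bmeas_fejer_mean.
rewrite -intTD//; apply: le_intT; [exact: bmeas_dist|exact: bmeasD|move=> t _].
rewrite cabsB (le_trans (cabs_le _))//.
by rewrite cReD cReN cImD cImN pE.
Qed.

End fejer.

(** * Poisson means of real functions, and bounds uniform in the radius *)

Section poisson_real.
Context {R : realType}.
Local Notation C := (complex.complex R).
Local Notation T := (@Tdom R).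
Implicit Types (F : R -> C) (w h : R -> R) (t rho : R).

Definition poisson_mean rho w : R :=
  (2 * pi)^-1 * intT (fun t => poisson_kernel rho t * w t).

Lemma poisson_rc rho w : poisson rho (fun t => rc (w t)) = rc (poisson_mean rho w).
Proof.
rewrite /poisson /poisson_mean rcM -cintT_rc; congr (_ * _).
by apply: eq_cintT => t _; rewrite -rcM.
Qed.

Variable rho : R.
Hypothesis rho01 : 0 <= rho < 1.

Let bP : bmeas (poisson_kernel rho).
Proof. exact: bmeas_poisson_kernel. Qed.

Let bPM w : bmeas w -> bmeas (fun t => poisson_kernel rho t * w t).
Proof. exact: bmeasM. Qed.

Lemma poisson_mean_le w h : bmeas w -> bmeas h -> (forall t, T t -> w t <= h t) ->
  poisson_mean rho w <= poisson_mean rho h.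
Proof.
move=> bw bh wh; rewrite ler_pM2l ?invr_gt0 ?pi2_gt0//.
apply: le_intT; [exact: bPM|exact: bPM|move=> t Tt].
by rewrite ler_wpM2l ?poisson_kernel_ge0 ?wh.
Qed.

Lemma poisson_mean_cst (c : R) : poisson_mean rho (fun=> c) = c.
Proof.
by apply: (@complexI R); have := poisson_rc rho (fun=> c); rewrite poisson_cst// => <-.
Qed.

Lemma poisson_mean_cos : poisson_mean rho cos = rho.
Proof.
rewrite -[RHS]cRe_rc -[rc rho]expr1 -(poisson_moment rho01 1) /poisson cRe_rcM.
by congr (_ * _); apply: eq_intT => t _; rewrite cRe_rcM expr1.
Qed.

Lemma poisson_meanD w h : bmeas w -> bmeas h ->
  poisson_mean rho (fun t => w t + h t) = poisson_mean rho w + poisson_mean rho h.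
Proof.
move=> bw bh; rewrite /poisson_mean -mulrDr -intTD; [|exact: bPM..].
by congr (_ * _); apply: eq_intT => t _; rewrite mulrDr.
Qed.

Lemma poisson_meanZ (c : R) w : bmeas w ->
  poisson_mean rho (fun t => c * w t) = c * poisson_mean rho w.
Proof.
move=> bw; rewrite /poisson_mean [RHS]mulrCA -(intTZ c); last exact: bPM.
by congr (_ * _); apply: eq_intT => t _; rewrite mulrCA.
Qed.

Lemma poisson_mean_1subcos e K :
  poisson_mean rho (fun t => e + K * (1 - cos t)) = e + K * (1 - rho).
Proof.
have bc : bmeas (@cos R) by case: (@cbmeas_expi1 R).
have bN : bmeas (fun t : R => -1 * cos t) by exact: bmeasZ.
have -> : (fun t : R => e + K * (1 - cos t)) = (fun t => e + K * (1 + -1 * cos t)).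
  by apply/funext => t; rewrite mulN1r.
have b1 : bmeas (fun t : R => 1 + -1 * cos t) by apply: bmeasD => //; exact: bmeas_cst.
rewrite poisson_meanD; [|exact: bmeas_cst|exact: bmeasZ].
rewrite poisson_meanZ// poisson_meanD//; last exact: bmeas_cst.
by rewrite poisson_meanZ// poisson_mean_cos !poisson_mean_cst mulN1r.
Qed.

(** Unlike [poisson_bound], this has constants independent of [rho]. Since [cos] has Poisson mean
    [rho], the barrier [K * (1 - cos t)] contributes only [K * (1 - rho)]; the factor 2 is that of
    [cabs_cintT]. *)
Lemma cabs_poisson F e K : cbmeas F ->
  (forall t, T t -> cabs (F t) <= e + K * (1 - cos t)) ->
  cabs (poisson rho F) <= 2 * (e + K * (1 - rho)).
Proof.
move=> bF FK; rewrite -poisson_mean_1subcos /poisson cabsM cabs_rc.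
rewrite gtr0_norm ?invr_gt0 ?pi2_gt0// /poisson_mean mulrCA.
rewrite ler_pM2l ?invr_gt0 ?pi2_gt0//.
have bPF : cbmeas (fun t => rc (poisson_kernel rho t) * F t).
  by apply: cbmeasM => //; exact: cbmeas_rc.
rewrite (le_trans (cabs_cintT bPF))// ler_pM2l//.
apply: le_intT; first exact: bmeas_cabs.
  apply: bPM; apply: bmeasD; first exact: bmeas_cst.
  apply: bmeasZ; apply: bmeasB; first exact: bmeas_cst.
  by case: (@cbmeas_expi1 R).
move=> t Tt; rewrite cabsM cabs_rc ger0_norm ?poisson_kernel_ge0//.
by rewrite ler_wpM2l ?poisson_kernel_ge0 ?FK.
Qed.

End poisson_real.

(** * Lower bounds for the Poisson kernel on an arc comparable to [1 - rho] *)

Section poisson_lower_bound.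
Context {R : realType}.
Local Notation T := (@Tdom R).

Lemma ler_norm_sin (x : R) : `|sin x| <= `|x|.
Proof.
wlog x0 : x / 0 <= x.
  by move=> H; have [/H//|/ltW x0] := leP 0 x; rewrite -normrN -sinN -(normrN x) H// oppr_ge0.
have [<-|nx0] := eqVneq 0 x; first by rewrite sin0.
have {nx0}x0 : 0 < x by rewrite lt_neqAle nx0.
have cs : {within `[0, x], continuous sin}.
  by apply: continuous_subspaceT; exact: continuous_sin.
have [c _] := MVT x0 (fun y _ => is_derive_sin y) cs.
rewrite sin0 !subr0 => ->.
by rewrite normrM ler_piMl// cos_max.
Qed.

Lemma one_sub_cos_le (x : R) : 1 - cos x <= x ^+ 2 / 2.
Proof.
have h : x = (x / 2) *+ 2 by rewrite -mulr_natr -mulrA mulVf ?mulr1.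
have e : 1 - cos x = 2 * sin (x / 2) ^+ 2.
  by rewrite {1}h cos_mulr2n cos2sin2 -mulr_natl; ring.
rewrite e.
have : `|sin (x / 2)| ^+ 2 <= `|x / 2| ^+ 2 by rewrite ler_pXn2r ?nnegrE ?ler_norm_sin.
by rewrite !real_normK ?num_real// expr_div_n; lra.
Qed.

(** The numerator is [theta * (2 - theta) >= theta], and the denominator
    [theta^2 + 2 (1 - theta) (1 - cos t)] is at most [2 * theta^2] because
    [1 - cos t <= t^2 / 2]. *)
Lemma poisson_kernel_ge (theta t : R) : 0 < theta <= 1 -> `|t| <= theta ->
  (2 * theta)^-1 <= poisson_kernel (1 - theta) t.
Proof.
move=> /andP[th0 th1] tth.
have rho01 : 0 <= 1 - theta < 1 by rewrite subr_ge0 th1/= gtrBl.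
have D0 := poisson_den_gt0 rho01 t.
rewrite /poisson_kernel ler_pdivlMr// ler_pdivrMl ?mulr_gt0//.
have t2 : t ^+ 2 <= theta ^+ 2.
  by rewrite -real_normK ?num_real// ler_pXn2r ?nnegrE// ltW.
have cost := one_sub_cos_le t; have c1 := cos_le1 t.
have D2 : poisson_den (1 - theta) t <= 2 * theta ^+ 2.
  have -> : poisson_den (1 - theta) t = theta ^+ 2 + 2 * (1 - theta) * (1 - cos t).
    by rewrite /poisson_den; ring.
  have : (1 - theta) * (1 - cos t) <= 1 * (1 - cos t).
    by rewrite ler_wpM2r ?subr_ge0// gerBl ltW.
  by lra.
apply: (le_trans D2).
have -> : 2 * theta * (1 - (1 - theta) ^+ 2) = 2 * theta ^+ 2 * (2 - theta) by ring.
by rewrite ler_peMr ?mulr_ge0 ?sqr_ge0//; lra.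
Qed.

(** The kernel is at least the inverse of the length [2 * theta] of the arc, so a proportion [c] of
    the arc weighs at least [c / (2 * pi)]. A general [w] covers both an indicator and its
    complement. *)
Lemma poisson_mean_ge (theta c : R) (w : R -> R) (E : set R) : 0 < theta <= 1 ->
  bmeas w -> measurable E -> (forall t, T t -> 0 <= w t) ->
  (forall t, T t -> E t -> `|t| <= theta /\ 1 <= w t) ->
  c * (2 * theta) <= intT (\1_E) ->
  c / (2 * pi) <= poisson_mean (1 - theta) w.
Proof.
move=> th bw mE w0 wE cE; have /andP[th0 th1] := th.
have rho01 : 0 <= 1 - theta < 1 by rewrite subr_ge0 th1/= gtrBl.
rewrite mulrC ler_pM2l ?invr_gt0 ?pi2_gt0//.
have b1 := bmeas_indic mE.
apply: (@le_trans _ _ ((2 * theta)^-1 * intT (\1_E))).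
  by rewrite ler_pdivlMl ?mulr_gt0// mulrC.
rewrite -intTZ//; apply: le_intT; first exact: bmeasZ.
  exact: bmeasM (bmeas_poisson_kernel rho01) bw.
move=> t Tt; rewrite indicE; case: (boolP (t \in E)) => [/set_mem Et|_].
  have [tth w1] := wE t Tt Et.
  by rewrite ler_pM ?invr_ge0 ?mulr_ge0 ?(ltW th0)// poisson_kernel_ge.
by rewrite mulr0 mulr_ge0 ?w0 ?poisson_kernel_ge0.
Qed.

End poisson_lower_bound.

(** * Poisson means of sets whose indicator is nearly analytic around 1 *)

Section indicator_gap.
Context {R : realType}.
Local Notation C := (complex.complex R).
Local Notation T := (@Tdom R).

Lemma le_far_cos (d B e x t : R) : 0 < d -> d <= pi -> 0 <= e -> 0 <= B -> T t ->
  x <= B -> (`|t| <= d -> x <= e) -> x <= e + B / (1 - cos d) * (1 - cos t).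
Proof.
move=> d0 dpi e0 B0 /TdomE tpi xB xe.
have cd : 0 < 1 - cos d by rewrite subr_gt0 cos_lt1.
have [/xe td|td] := leP `|t| d.
  rewrite ler_wpDr// mulr_ge0 ?subr_ge0 ?cos_le1// divr_ge0// ltW//.
rewrite ler_wpDl// (le_trans xB)// mulrAC ler_pdivlMr// ler_wpM2l//.
rewrite lerD2l lerN2 cos_far ?(ltW d0) ?(ltW td)//.
by lra.
Qed.

Lemma one_sub_expn_le k (e : R) : 0 < e ->
  exists2 tau, 0 < tau & forall z : C, cabs (z - 1) <= tau -> cabs (z ^+ k - 1) <= e.
Proof.
elim: k e => [|k IH] e e0.
  by exists 1 => // z _; rewrite expr0 subrr cabs0 ltW.
have [tau tau0 H] := IH _ (divr_gt0 e0 (ltr0n R 4)).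
(* The bound 1 gives [cabs z <= 2], so the error [e / 4] from the induction costs [e / 2], and
   [z - 1] costs the other half. *)
exists (Num.min tau (Num.min 1 (e / 2))).
  by rewrite !lt_min tau0 ltr01 divr_gt0.
move=> z; rewrite !le_min => /and3P[/H zk z1 z2].
have -> : z ^+ k.+1 - 1 = z * (z ^+ k - 1) + (z - 1) by rewrite exprS; ring.
rewrite (le_trans (le_cabsD _ _))// cabsM.
have z3 : cabs z <= 2.
  rewrite -[z](subrK 1) (le_trans (le_cabsD _ _))// cabs1.
  by rewrite -[2]/(1 + 1) lerD2r.
have := ler_pM (cabs_ge0 _) (cabs_ge0 _) z3 zk.
lra.
Qed.

Lemma poisson_mean_indic01 (rho : R) (E : set R) : 0 <= rho < 1 -> measurable E ->
  0 <= poisson_mean rho (\1_E) <= 1.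
Proof.
move=> rho01 mE; have bE := bmeas_indic mE; apply/andP; split.
  rewrite -(poisson_mean_cst rho01 0); apply: poisson_mean_le => //.
  exact: bmeas_cst.
rewrite -[leRHS](poisson_mean_cst rho01 1); apply: poisson_mean_le => //.
exact: bmeas_cst.
Qed.

(* Multiplicativity of the Poisson functional: if [v] is close to the indicator
   of [E], then so is [v ^ 2], and the mean [m] of [E] is close to [m ^ 2]. *)
Lemma analytic_indicator_gap (v : R -> C) (E : set R) (d e : R) :
  analytic_approx v -> measurable E -> 0 < d -> d <= pi -> 0 < e -> e <= 1 ->
  (forall t, T t -> `|t| <= d -> cabs (v t - rc (\1_E t)) <= e) ->
  exists2 eta, 0 < eta & forall rho, 0 <= rho < 1 -> 1 - rho <= eta ->
    poisson_mean rho (\1_E) * (1 - poisson_mean rho (\1_E)) <= 32 * e.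
Proof.
move=> av mE d0 dpi e0 e1 vE; have [bv _] := av.
have bE := bmeas_indic mE.
have bcE := cbmeas_rc bE.
have cd : 0 < 1 - cos d by rewrite subr_gt0 cos_lt1.
have [B [B0 vB]] := cbmeas_bounded bv.
have E1 (t : R) : cabs (rc (\1_E t : R)) <= 1.
  by rewrite indicE cabs_rc; case: (_ \in _); rewrite ?normr1 ?normr0.
(* Off the arc, [(B + 1) ^+ 2] bounds both errors, [B + 1] for [v] and [B ^+ 2 + 1] for its square,
   so one [K] serves twice. *)
pose K := (B + 1) ^+ 2 / (1 - cos d).
have BB : 0 <= (B + 1) ^+ 2 by exact: sqr_ge0.
have B1 : B + 1 <= (B + 1) ^+ 2 by rewrite expr2 ler_peMl//; lra.
have K0 : 0 <= K by rewrite divr_ge0// ltW.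
have h1 t : T t -> cabs (v t - rc (\1_E t)) <= e + K * (1 - cos t).
  move=> Tt; apply: le_far_cos => //; [exact: ltW| |exact: vE].
  rewrite (le_trans (le_cabsB _ _))// (le_trans _ B1)// lerD ?vB ?E1//.
have h2 t : T t -> cabs (v t * v t - rc (\1_E t)) <= 3 * e + K * (1 - cos t).
  move=> Tt; apply: le_far_cos => //; first by rewrite mulr_ge0 ?ltW.
    rewrite (le_trans (le_cabsB _ _))// cabsM.
    have := ler_pM (cabs_ge0 _) (cabs_ge0 _) (vB _ Tt) (vB _ Tt).
    by have := E1 t; lra.
  move=> td; have ve := vE t Tt td.
  (* An indicator is idempotent, so the error of the square factors; the second factor is at most
     [e + 2 <= 3]. *)
  have -> : v t * v t - rc (\1_E t) = (v t - rc (\1_E t)) * ((v t - rc (\1_E t)) + rc (2 * \1_E t)).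
    have : (\1_E t : R) = \1_E t * \1_E t.
      by rewrite indicE; case: (_ \in _); rewrite ?mulr1 ?mulr0.
    move: (\1_E t : R) (v t) => x z xx; rewrite {1}xx.
    by rewrite !rcM (_ : rc 2 = 2); [ring|rewrite /rc rmorph_nat].
  rewrite cabsM mulrC ler_pM ?cabs_ge0//.
  rewrite (le_trans (le_cabsD _ _))// rcM cabsM.
  have := E1 t; rewrite (cabs_rc 2) ger0_norm//; lra.
exists (e / (K + 1)); first by rewrite divr_gt0// ltr_wpDl.
move=> rho rho01; rewrite ler_pdivlMr ?ltr_wpDl// => rhoK.
have rho1 : 0 <= 1 - rho by case/andP : rho01 => _ /ltW; rewrite subr_ge0.
have KK : K * (1 - rho) <= e by rewrite mulrC; lra.
set m := poisson_mean rho (\1_E).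
have a1 : cabs (poisson rho v - rc m) <= 4 * e.
  rewrite -poisson_rc -poissonB//.
  apply: (le_trans (cabs_poisson rho01 (cbmeasB bv bcE) h1)); lra.
have a2 : cabs (poisson rho v * poisson rho v - rc m) <= 8 * e.
  have bvv := cbmeasM bv bv.
  rewrite -poissonM// -poisson_rc -poissonB//.
  apply: (le_trans (cabs_poisson rho01 (cbmeasB bvv bcE) h2)); lra.
have /andP[m0 m1] := poisson_mean_indic01 rho01 mE.
rewrite -/m in m0 m1; clearbody m; move: (poisson rho v) a1 a2 => z a1 a2.
have -> : m * (1 - m) = `|m * (1 - m)| by rewrite ger0_norm// mulr_ge0// subr_ge0.
rewrite -cabs_rc.
(* That is, [m - m^2 = (z - m) (z + m) - (z^2 - m)], bounded by [4 e * 6 + 8 e]; this is the origin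
   of 32. *)
have -> : rc (m * (1 - m)) = (z - rc m) * ((z - rc m) + rc (2 * m)) - (z * z - rc m).
  by rewrite !rcM rcB rc1 (_ : rc 2 = 2); [ring|rewrite /rc rmorph_nat].
rewrite (le_trans (le_cabsB _ _))// cabsM.
have a3 : cabs (z - rc m + rc (2 * m)) <= 6.
  by rewrite (le_trans (le_cabsD _ _))// cabs_rc ger0_norm ?mulr_ge0//; lra.
have := ler_pM (cabs_ge0 _) (cabs_ge0 _) a1 a3; lra.
Qed.

End indicator_gap.

(** * Essential suprema, exceptional null sets and truncation *)

Section essential_bounds.
Context {R : realType}.
Local Notation C := (complex.complex R).
Local Notation T := (@Tdom R).
Local Notation leb := (@lebesgue_measure R).
Implicit Types (f : R -> C).

Lemma ess_sup_on_ae (D : set R) (g : R -> \bar R) :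
  \forall t \ae leb, D t -> (g t <= ess_sup_on D g)%E.
Proof.
apply: filterS (ess_sup_ge leb (fun x => if x \in D then g x else -oo%E)) => t + Dt.
by rewrite mem_set.
Qed.

Lemma ae_and (P Q : R -> Prop) :
  (\forall t \ae leb, P t) -> (\forall t \ae leb, Q t) ->
  \forall t \ae leb, P t /\ Q t.
Proof. exact: (@filterI _ _ (ae_filter_ringOfSetsType leb)). Qed.

Lemma Linf_norm_ge0 f : (0 <= Linf_norm f)%E.
Proof.
rewrite leNgt; apply/negP => f0.
have [N [mN N0 sN]] := @ess_sup_on_ae T (fun t => (cabs (f t))%:E).
have : (leb T <= leb N)%E.
  apply: le_measure; rewrite ?inE//; first exact: measurable_Tdom.
  move=> t Tt; apply: sN => /(_ Tt) h.
  by have := le_lt_trans h f0; rewrite lte_fin ltNge cabs_ge0.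
by rewrite N0 lebesgue_Tdom lee_fin leNgt pi2_gt0.
Qed.

Lemma Linf_normE f : (Linf_norm f < +oo)%E ->
  exists2 M, Linf_norm f = M%:E & 0 <= M.
Proof.
have := Linf_norm_ge0 f; case: (Linf_norm f) => // M M0 _.
by exists M.
Qed.

Lemma Linf_norm_eq f g : f =1 g -> Linf_norm f = Linf_norm g.
Proof. by move=> /funext ->. Qed.

Lemma Hinf0_zero : is_Hinf0 (fun=> 0 : C).
Proof.
have z (n : int) : fourier_coef (fun=> 0 : C) n = 0.
  rewrite fourier_coefE (_ : cintT _ = 0) ?mulr0//.
  rewrite -rc0 -[in RHS](mulr0 (2 * pi)) -intT_cst -cintT_rc.
  by apply: eq_cintT => t _; rewrite mul0r.
split => //; split => //; split; first exact: measurable_cst.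
split; first exact: measurable_cst.
apply: (@le_lt_trans _ _ 0%E); last by rewrite ltry.
apply/ess_supP/aeW => t /=; case: (t \in T) => //.
by rewrite cabs0.
Qed.

(** A function of H^oo is bounded only almost everywhere. Replacing it by 0 on a null set makes it
    bounded everywhere and leaves its Fourier coefficients unchanged. The set [N] is a parameter so
    that several functions can share it. *)
Lemma is_Hinf_trunc f (N : set R) (M : R) : is_Hinf f ->
  measurable N -> leb N = 0%E ->
  (forall t, T t -> ~ N t -> cabs (f t) <= M) -> 0 <= M ->
  analytic_approx (fun t => rc (\1_(~` N) t) * f t).
Proof.
move=> [[m1 [m2 _]] f0] mN N0 fM M0.
have mNC : measurable (~` N) by exact: measurableC.
have mI : measurable_fun T (\1_(~` N) : R -> R) by exact: measurable_indic.
have bf : cbmeas (fun t => rc (\1_(~` N) t) * f t).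
  have fM' t : T t -> cabs (rc (\1_(~` N) t) * f t) <= M.
    move=> Tt; rewrite cabsM cabs_rc indicE; case: (boolP (t \in ~` N)) => [/set_mem Nt|_].
      by rewrite normr1 mul1r fM.
    by rewrite normr0 mul0r.
  split; split.
  - by under eq_fun do rewrite cRe_rcM; exact: measurable_funM.
  - by exists M => t Tt; rewrite (le_trans (norm_cRe _))// fM'.
  - by under eq_fun do rewrite cIm_rcM; exact: measurable_funM.
  - by exists M => t Tt; rewrite (le_trans (norm_cIm _))// fM'.
apply: fourier_analytic_approx => // n n0; rewrite -(f0 n n0) !fourier_coefE; congr (_ * _).
have trunc (g : R -> R) : measurable_fun T g ->
    intT (fun t => \1_(~` N) t * g t) = intT g.
  move=> mg; rewrite /intT /Rintegral; congr fine; apply: ae_eq_integral.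
  - exact: measurable_Tdom.
  - by apply/measurable_EFinP; exact: measurable_funM.
  - exact/measurable_EFinP.
  - exists N; split => // t /=; apply: contra_notP => nNt Tt.
    by rewrite indicE mem_set// mul1r.
have [mc ms] : measurable_fun T (fun t : R => cRe (expi (- (n%:~R * t)))) /\
               measurable_fun T (fun t : R => cIm (expi (- (n%:~R * t)))).
  have [[mc _] [ms _]] := @cbmeas_expi R (- n%:~R).
  by split; [move: mc|move: ms]; under eq_fun do rewrite mulNr.
congr cmk.
  rewrite -[RHS]trunc; last first.
    by under eq_fun do rewrite cReM; apply: measurable_funB; exact: measurable_funM.
  by apply: eq_intT => t _; rewrite -mulrA cRe_rcM.
rewrite -[RHS]trunc; last first.
  by under eq_fun do rewrite cImM; apply: measurable_funD; exact: measurable_funM.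
by apply: eq_intT => t _; rewrite -mulrA cIm_rcM.
Qed.

Lemma measurable_cabs_lt f M : measurable_fun T (fun t => cRe (f t)) ->
  measurable_fun T (fun t => cIm (f t)) -> measurable (T `&` [set t | cabs (f t) < M]).
Proof.
move=> m1 m2; have mc : measurable_fun T (fun t => cabs (f t)).
  apply: (@measurableT_comp _ _ _ _ _ _ (@Num.sqrt R)).
    by apply: continuous_measurable_fun; exact: sqrt_continuous.
  by apply: measurable_funD; exact: measurable_funX.
have := mc measurable_Tdom _ (measurable_itv `]-oo, M[).
by congr measurable; apply/seteqP; split => t /=; rewrite in_itv.
Qed.

End essential_bounds.

(** * Densities in the arcs [Gamma], as integrals of indicators *)

Section gamma.
Context {R : realType}.
Local Notation T := (@Tdom R).
Local Notation leb := (@lebesgue_measure R).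

Lemma GammaE (th : R) : th <= pi -> Gamma th = `[- th, th]%classic.
Proof.
move=> thpi; apply/seteqP; split => t /=; rewrite in_itv/= -ler_norml; first by case.
by move=> tth; split => //; apply/TdomE; exact: le_trans tth thpi.
Qed.

Lemma intT_indic_ge (th a : R) (A : set R) : 0 < th -> th <= pi -> measurable A ->
  (a%:E * tmeas (Gamma th) <= tmeas A)%E -> a * (2 * th) <= intT (\1_A).
Proof.
move=> th0 thpi mA; rewrite /tmeas -(intT_indic mA).
have -> : T `&` Gamma th = `[- th, th]%classic.
  by rewrite -GammaE//; apply/seteqP; split => t; [case|move=> h; split => //; case: h].
rewrite lebesgue_measure_itv/= lte_fin gtrN// -EFinB -!EFinM lee_fin.
rewrite mulrA ler_pM2r ?invr_gt0 ?pi2_gt0// opprK.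
by rewrite mulr_natl mulr2n.
Qed.

End gamma.

(** * Contradiction from a function at distance less than the norm *)

Theorem theorem6 (R : realType) (phi : R -> complex.complex R) :
  is_Hinf phi ->
  (fun th : R => ess_sup_on (Gamma th `&` Lminus phi 1)
                   (fun t => (cabs (phi t))%:E)) @ 0^'+ --> 0%E ->
  (exists th : nat -> R,
     (forall n, 0 < th n <= pi) /\ th @ \oo --> 0 /\
     exists a b : R, 0 < a /\ 0 < b /\
       forall n,
         (tmeas (Gamma (th n) `&` Lminus phi 1) >= a%:E * tmeas (Gamma (th n)))%E /\
         (tmeas (Gamma (th n) `&` Lplus phi 1) >= b%:E * tmeas (Gamma (th n)))%E) ->
  saturated phi.
Proof.
move=> Hphi lim0 [th [th0 [thcvg [a [b [a0 [b0 dens]]]]]]].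
have [[m1 [m2 fin]] _] := Hphi.
have [M ME M0] := Linf_normE fin.
apply/eqP; rewrite eq_le; apply/andP; split; last first.
  apply: ereal_inf_lbound; exists (fun=> 0); first exact: Hinf0_zero.
  apply: Linf_norm_eq => t; rewrite (_ : cconj 0 = 0) ?subr0//.
  by apply: ceqP => //=; rewrite oppr0.
apply/ereal_infP => _ [f [Hf _] <-]; rewrite leNgt ME; apply/negP => dist.
have [r rE r0] := Linf_normE (lt_trans dist (ltry M)).
have rM : r < M by move: dist; rewrite rE lte_fin.
have {M0}M0 : 0 < M by exact: le_lt_trans rM.
have [[_ [_ finf]] _] := Hf.
have [B BE B0] := Linf_normE finf.
have pi0 := @pi2_gt0 R.
(* The factors of [g] will bound [m] and [1 - m] from below. With [e <= g / 64] the upper bound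
   [32 * e] is at most [g / 2], a contradiction. *)
pose g := a / (2 * pi) * (b / (2 * pi)).
have g0 : 0 < g by rewrite mulr_gt0// divr_gt0.
pose e := Num.min 1 (g / 64).
have e0 : 0 < e by rewrite lt_min ltr01 divr_gt0.
have e1 : e <= 1 by rewrite ge_min lexx.
have eg : e <= g / 64 by rewrite ge_min lexx orbT.
have [k rk] : exists k, (r / M) ^+ k <= e.
  have : `|r / M| < 1 by rewrite ger0_norm ?divr_ge0 ?(ltW M0)// ltr_pdivrMr// mul1r.
  move=> /cvg_expr/cvgrPdist_le/(_ _ e0)[k _ /(_ k (leqnn k))]/=.
  by rewrite sub0r normrN => h; exists k; exact: le_trans (ler_norm _) h.
have [tau tau0 tauP] := one_sub_expn_le k e0.
(* If [cabs phi <= eta] and [cabs f <= B], then [phi f / M^2] has modulus at most [tau]. The power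
   [k] is already fixed by [e], [tau] by [k], and the arc [d] is chosen last. *)
pose eta := tau * M ^+ 2 / (B + 1).
have B10 : 0 < B + 1 by rewrite ltr_wpDl.
have eta0 : 0 < eta by rewrite divr_gt0// mulr_gt0// exprn_gt0.
have [d [[d0 dpi] essd]] : exists d : R, (0 < d /\ d <= pi) /\
    (ess_sup_on (Gamma d `&` Lminus phi 1) (fun t => (cabs (phi t))%:E) < eta%:E)%E.
  have nb : nbhs (0%E : \bar R) [set x | x < eta%:E]%E.
    rewrite /nbhs/=; near=> x; rewrite /= lte_fin; near: x; exact: lt_nbhsl.
  near (0 : R)^'+ => d; exists d; split; [split|]; near: d.
  - exact: nbhs_right_gt.
  - exact: nbhs_right_le (pi_gt0 R).
  - exact: lim0 _ nb.
have LE : Lminus phi 1 = @Tdom R `&` [set t | cabs (phi t) < M].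
  by rewrite /Lminus ME mule1; apply/seteqP; split => t /=; rewrite lte_fin.
have LPE : Lplus phi 1 = @Tdom R `&` [set t | M <= cabs (phi t)].
  by rewrite /Lplus ME mule1; apply/seteqP; split => t /=; rewrite lee_fin.
have mL : measurable (Lminus phi 1) by rewrite LE; exact: measurable_cabs_lt.
have mLp : measurable (Lplus phi 1).
  rewrite (_ : Lplus phi 1 = @Tdom R `\` Lminus phi 1).
    by apply: measurableD => //; exact: measurable_Tdom.
  rewrite LE LPE; apply/seteqP; split => t /= [Tt]; rewrite ?leNgt => h; split => //.
    by move=> [_]; rewrite (negbTE h).
  by apply/negP => ?; apply: h.
(* One null set outside which all four essential bounds hold pointwise. *)
have [N [mN N0 sN]] : \forall t \ae (@lebesgue_measure R),
    ((Tdom t -> (cabs (phi t))%:E <= Linf_norm phi)%E /\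
     (Tdom t -> (cabs (phi t - cconj (f t))%R)%:E <=
                Linf_norm (fun t => phi t - cconj (f t))%R)%E) /\
    ((Tdom t -> (cabs (f t))%:E <= Linf_norm f)%E /\
     ((Gamma d `&` Lminus phi 1) t -> (cabs (phi t))%:E <=
        ess_sup_on (Gamma d `&` Lminus phi 1) (fun t => (cabs (phi t))%:E))%E).
  by apply: ae_and; apply: ae_and; exact: ess_sup_on_ae.
have nN t : Tdom t -> ~ N t -> [/\ cabs (phi t) <= M, cabs (phi t - cconj (f t)) <= r,
    cabs (f t) <= B & (`|t| <= d -> cabs (phi t) < M -> cabs (phi t) <= eta)].
  move=> Tt nNt; have : ~ ~ _ := fun h => nNt (sN t h).
  move=> /contrapT/= [[h1 h2] [h3 h4]]; split.
  - by rewrite -lee_fin -ME; exact: h1.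
  - by rewrite -lee_fin -rE; exact: h2.
  - by rewrite -lee_fin -BE; exact: h3.
  - move=> td pM; rewrite -lee_fin; apply: le_trans (ltW essd); apply: h4.
    by rewrite LE.
have aphi := is_Hinf_trunc Hphi mN N0 (fun t Tt nNt => let: And4 h _ _ _ := nN t Tt nNt in h) (ltW M0).
have af := is_Hinf_trunc Hf mN N0 (fun t Tt nNt => let: And4 _ _ h _ := nN t Tt nNt in h) B0.
pose u t := 1 - rc (M ^- 2) * ((rc (\1_(~` N) t) * phi t) * (rc (\1_(~` N) t) * f t)).
have au : analytic_approx u.
  apply: analytic_approxB; first exact: analytic_approx_cst.
  by apply: analytic_approxM; [exact: analytic_approx_cst|exact: analytic_approxM].
(* On [N] the truncated functions vanish and [u = 1], so adding [N] to the set makes the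
   approximation valid at every point of the arc. *)
pose E := Lminus phi 1 `|` N.
have mE : measurable E by exact: measurableU.
have uE t : Tdom t -> `|t| <= d -> cabs (u t ^+ k - rc (\1_E t)) <= e.
  move=> Tt td; have [Nt|nNt] := pselect (N t).
    have tNC : (t \in ~` N) = false by apply: memNset => /(_ Nt).
    rewrite /u !indicE tNC (_ : t \in E); last by apply: mem_set; right.
    rewrite [rc false%:R]rc0 !mul0r mulr0 subr0 expr1n.
    by rewrite [rc true%:R]rc1 subrr cabs0 ltW.
  have [h1 h2 h3 h4] := nN t Tt nNt.
  have -> : u t = 1 - rc (M ^- 2) * (phi t * f t).
    by rewrite /u indicE mem_set// [rc true%:R]rc1 !mul1r.
  rewrite indicE; have [ptM|ptM] := ltP (cabs (phi t)) M.
    rewrite mem_set; last by left; rewrite LE.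
    rewrite [rc true%:R]rc1; apply: tauP.
    rewrite [X in cabs X](_ : _ = - (rc (M ^- 2) * (phi t * f t))); last by ring.
    rewrite cabsN !cabsM cabs_rc gtr0_norm ?invr_gt0 ?exprn_gt0//.
    rewrite ler_pdivrMl ?exprn_gt0// [leRHS]mulrC.
    apply: (@le_trans _ _ (eta * (B + 1))).
      rewrite ler_pM ?cabs_ge0 ?h4// (le_trans h3)// lerDl//.
    by rewrite /eta divfK// gt_eqF.
  rewrite memNset; last first.
    by rewrite /E LE => -[[_ /=]|//]; rewrite ltNge ptM.
  rewrite [rc false%:R]rc0 subr0 cabsX (le_trans _ rk)// lerXn2r ?nnegrE ?cabs_ge0//.
    by rewrite divr_ge0// ltW.
  have pE : cabs (phi t) = M by apply/eqP; rewrite eq_le h1 ptM.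
  (* Here [cabs (phi t) = M], so 1 is [phi * conj phi / M^2], and the modulus is at most
     [M * r / M^2 = r / M]. *)
  have -> : 1 - rc (M ^- 2) * (phi t * f t) =
      rc (M ^- 2) * (phi t * cconj (phi t - cconj (f t))).
    rewrite cconjB cconjK mulrBr -cabs_sqr_conj pE mulrBr -rcM mulVf ?rc1//.
    by rewrite gt_eqF// exprn_gt0.
  rewrite !cabsM cabs_conj cabs_rc gtr0_norm ?invr_gt0 ?exprn_gt0// pE.
  rewrite ler_pdivrMl ?exprn_gt0//.
  have -> : M ^+ 2 * (r / M) = M * r by field; rewrite gt_eqF.
  by rewrite ler_pM2l.
have [eta' eta'0 gap] := analytic_indicator_gap (analytic_approxX k au) mE d0 dpi e0 e1 uE.
(* A single small arc suffices; [th n <= 1] places [1 - th n] in the range of the Poisson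
   integral. *)
have [n [thn1 thn2]] : exists n, th n <= 1 /\ th n <= eta'.
  have e'0 : 0 < Num.min 1 eta' by rewrite lt_min ltr01.
  have /cvgrPdist_le/(_ _ e'0)[n _ /(_ n (leqnn n))]/= := thcvg.
  rewrite sub0r normrN le_min => /andP[h1 h2]; exists n.
  by split; apply: le_trans (ler_norm _) _.
have /andP[thn0 thnpi] := th0 n.
have rho01 : 0 <= 1 - th n < 1 by rewrite subr_ge0 thn1/= gtrBl.
have := gap _ rho01; rewrite subKr => /(_ thn2).
have th01 : 0 < th n <= 1 by rewrite thn0.
have mG : measurable (Gamma (th n)) by rewrite GammaE//; exact: measurable_itv.
have bE := bmeas_indic mE.
have [dm dp] := dens n.
have ma : a / (2 * pi) <= poisson_mean (1 - th n) (\1_E).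
  have mGL : measurable (Gamma (th n) `&` Lminus phi 1) by exact: measurableI.
  apply: (poisson_mean_ge th01 bE mGL) => //.
    move=> t Tt [[_ tth] tL]; split => //.
    by rewrite indicE mem_set//; left.
  exact: intT_indic_ge.
have mb : b / (2 * pi) <= 1 - poisson_mean (1 - th n) (\1_E).
  have bw : bmeas (fun t : R => 1 + -1 * \1_E t).
    by apply: bmeasD; [exact: bmeas_cst|exact: bmeasZ].
  have -> : 1 - poisson_mean (1 - th n) (\1_E) =
      poisson_mean (1 - th n) (fun t => 1 + -1 * \1_E t).
    rewrite poisson_meanD//; [|exact: bmeas_cst|exact: bmeasZ].
    by rewrite poisson_mean_cst// poisson_meanZ// mulN1r.
  have mGL : measurable (Gamma (th n) `&` Lplus phi 1) by exact: measurableI.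
  (* Since [E] contains [N], its complement is at hand only on [L^+] minus [N]; removing the null
     set costs no measure. *)
  have mGLN : measurable ((Gamma (th n) `&` Lplus phi 1) `\` N) by exact: measurableD.
  apply: (poisson_mean_ge th01 bw mGLN).
  - by move=> t Tt; rewrite mulN1r subr_ge0.
  - move=> t Tt [[[_ tth] tL] tN]; split => //.
    rewrite indicE memNset ?mulr0 ?addr0//.
    by move: tL; rewrite /E LE LPE => -[_ /= Mt] [[_ /=]|//]; rewrite ltNge Mt.
  apply: intT_indic_ge => //; apply: (le_trans dp).
  rewrite /tmeas lee_pmul2r ?lte_fin ?invr_gt0//.
  have mTGL := measurableI _ _ (@measurable_Tdom R) mGL.
  rewrite [leLHS](measureDI (@lebesgue_measure R) mTGL mN).
  rewrite [X in (_ + X)%E](_ : _ = 0%E) ?adde0 ?setIDA//.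
  by apply: (subset_measure0 _ mN) => //; exact: measurableI.
have : g <= poisson_mean (1 - th n) (\1_E) * (1 - poisson_mean (1 - th n) (\1_E)).
  by rewrite ler_pM ?divr_ge0 ?(ltW a0) ?(ltW b0) ?(ltW pi0).
lra.
Unshelve. all: by end_near. Qed.
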